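(* The Fraïssé limit of the class of all finite semigeneric tournaments has ample generics.
   Context: A directed graph is a structure with one binary relation which is irreflexive and antisymmetric (no loops, no bi-directional edges). A directed graph $\mathbf A$ is an $\omega$-partite tournament if its vertex set can be partitioned into countably many (possibly empty) pairwise disjoint sets $A_1,A_2,\ldots$, called parts, such that every pair of vertices in different parts is connected by a directed edge (in exactly one direction) and there are no edges between vertices in the same part. The parts are not named by the language. An $\omega$-partite tournament $\mathbf A$ is semigeneric if for every pair of parts $X$ and $Y$ of $\mathbf A$, and every $a\neq b\in X$ and $c\neq d\in Y$, the number of edges directed from $\{a,b\}$ to $\{c,d\}$ is even. A structure is homogeneous if every isomorphism between its finite substructures extends to an automorphism. The Fraïssé limit of a class $\mathcal C$ of finite structures is the (unique up to isomorphism) countable homogeneous structure such that the finite structures embedding into it are exactly the members of $\mathcal C$. For a countable structure $\mathbf M$, the group $G=\mathrm{Aut}(\mathbf M)$ carries the topology of pointwise convergence ($\mathbf M$ being discrete). For an integer $m\ge 1$, $\mathbf M$ has $m$-generic automorphisms if $G$ has a comeagre orbit on $G^m$ in its action by diagonal conjugation $g\cdot(h_1,\ldots,h_m)=(gh_1g^{-1},\ldots,gh_mg^{-1})$. $\mathbf M$ has ample generics if it has $m$-generic automorphisms for every $m\geq 1$. *)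

(* Defs.v *)
From HB Require Import structures.
From mathcomp Require Import all_boot monoid.
From mathcomp Require Import boolp classical_sets functions cardinality.
From mathcomp Require Import topology.

Set Implicit Arguments.
Unset Strict Implicit.
Unset Printing Implicit Defensive.

Local Open Scope classical_set_scope.

(** A structure in the language of one binary relation is a type [V] together
    with [r : rel V]. *)

Definition directed_graph (V : Type) (r : rel V) : Prop :=
  (forall x, ~~ r x x) /\ (forall x y, ~~ (r x y && r y x)).

(** The parts are indexed from 0 and may be empty. *)
Definition omega_partition (V : Type) (r : rel V) (A : nat -> set V) : Prop :=
  [/\ trivIset setT A,
      \bigcup_i A i = setT,
      forall i j x y, i != j -> A i x -> A j y -> r x y (+) r y x
    & forall i x y, A i x -> A i y -> ~~ r x y].

Definition omega_partite_tournament (V : Type) (r : rel V) : Prop :=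
  directed_graph r /\ exists A, omega_partition r A.

Definition edge_count (V : Type) (r : rel V) (a b c d : V) : nat :=
  \sum_(x <- [:: a; b]) \sum_(y <- [:: c; d]) r x y.

(** The nonempty parts are determined by [r] (they are the classes of
    non-adjacency), so the choice of the partition [A] is irrelevant. *)
Definition semigeneric_tournament (V : Type) (r : rel V) : Prop :=
  directed_graph r /\
  exists A, omega_partition r A /\
    forall i j a b c d, A i a -> A i b -> a <> b ->
      A j c -> A j d -> c <> d -> ~~ odd (edge_count r a b c d).

Definition embedding (V W : Type) (r : rel V) (e : rel W) (f : V -> W) : Prop :=
  injective f /\ forall x y, e (f x) (f y) = r x y.

Definition automorphism (M : Type) (e : rel M) : set (M -> M) :=
  [set f | bijective f /\ forall x y, e (f x) (f y) = e x y].

(** Isomorphisms between finite substructures are given by total functions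
    [f : M -> M] of which only the restriction to [A] matters. *)
Definition homogeneous (M : choiceType) (e : rel M) : Prop :=
  forall (A B : set M) (f : M -> M),
    finite_set A -> set_bij A B f ->
    (forall x y, A x -> A y -> e (f x) (f y) = e x y) ->
    exists2 g, automorphism e g & forall x, A x -> g x = f x.

Definition Fraisse_limit (C : forall T : finType, rel T -> Prop)
    (M : countType) (e : rel M) : Prop :=
  homogeneous e /\
  forall (T : finType) (r : rel T), (exists f, embedding r e f) <-> C T r.

(** Aut(M), with the topology induced by the topology of pointwise convergence
    on functions from [M] to the discrete space [M]. *)
Definition Aut (M : choiceType) (e : rel M) : Type :=
  set_type (automorphism e : set {ptws M -> discrete_topology M}).

HB.instance Definition _ (M : choiceType) (e : rel M) :=
  Topological.copy (Aut e)
    (set_type (automorphism e : set {ptws M -> discrete_topology M})).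

Section AutGroup.
Variables (M : choiceType) (e : rel M).

Definition aut_fun (g : Aut e) : M -> M := set_val g.
Coercion aut_fun : Aut >-> Funclass.

Lemma autP (g : Aut e) : automorphism e g.
Proof. exact: (set_valP g). Qed.

Lemma aut_ext (g h : Aut e) : g =1 h -> g = h.
Proof. by move=> gh; apply: val_inj; apply/funext. Qed.

Definition mk_aut (f : M -> M) (fP : automorphism e f) : Aut e :=
  SigSub (mem_set fP).

Lemma mk_autE f (fP : automorphism e f) : mk_aut fP = f :> (M -> M).
Proof. by []. Qed.

Lemma aut_one_subproof : automorphism e id.
Proof. by split=> //; exists id. Qed.

Lemma aut_mul_subproof (g h : Aut e) : automorphism e (g \o h).
Proof.
have [[bg eg] [bh eh]] := (autP g, autP h).
by split=> [|x y /=]; [exact: bij_comp | rewrite eg eh].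
Qed.

Lemma aut_inv_exists (g : Aut e) : exists2 f, cancel g f & cancel f g.
Proof. by case: (autP g) => -[f fK Kf] _; exists f. Qed.

Definition aut_inv_fun (g : Aut e) : M -> M := sval (cid2 (aut_inv_exists g)).

Lemma aut_funK (g : Aut e) : cancel g (aut_inv_fun g).
Proof. by rewrite /aut_inv_fun; case: cid2. Qed.

Lemma aut_invK (g : Aut e) : cancel (aut_inv_fun g) g.
Proof. by rewrite /aut_inv_fun; case: cid2. Qed.

Lemma aut_inv_subproof (g : Aut e) : automorphism e (aut_inv_fun g).
Proof.
split; first by exists g; [exact: aut_invK | exact: aut_funK].
by move=> x y; rewrite -(autP g).2 !aut_invK.
Qed.

Definition aut_one : Aut e := mk_aut aut_one_subproof.
Definition aut_mul (g h : Aut e) : Aut e := mk_aut (aut_mul_subproof g h).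
Definition aut_inv (g : Aut e) : Aut e := mk_aut (aut_inv_subproof g).

Lemma aut_mulA : associative aut_mul.
Proof. by move=> f g h; apply: aut_ext. Qed.

Lemma aut_1mul : left_id aut_one aut_mul.
Proof. by move=> g; apply: aut_ext. Qed.

Lemma aut_mul1 : right_id aut_one aut_mul.
Proof. by move=> g; apply: aut_ext. Qed.

Lemma aut_mulV : left_inverse aut_one aut_inv aut_mul.
Proof. by move=> g; apply: aut_ext => x; exact: aut_funK. Qed.

Lemma aut_Vmul : right_inverse aut_one aut_inv aut_mul.
Proof. by move=> g; apply: aut_ext => x; exact: aut_invK. Qed.

HB.instance Definition _ :=
  isGroup.Build (Aut e) aut_mulA aut_1mul aut_mul1 aut_mulV aut_Vmul.

End AutGroup.

Definition nowhere_dense (T : topologicalType) (S : set T) : Prop :=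
  interior (closure S) = set0.

Definition meagre (T : topologicalType) (S : set T) : Prop :=
  exists2 F : nat -> set T,
    (forall n, nowhere_dense (F n)) & S = \bigcup_n F n.

Definition comeagre (T : topologicalType) (S : set T) : Prop :=
  meagre (~` S).

Definition diag_conj (M : choiceType) (e : rel M) (m : nat)
    (g : Aut e) (h : {ptws 'I_m -> Aut e}) : {ptws 'I_m -> Aut e} :=
  fun i => (g * h i * g^-1)%g.

Definition diag_orbit (M : choiceType) (e : rel M) (m : nat)
    (h : {ptws 'I_m -> Aut e}) : set {ptws 'I_m -> Aut e} :=
  range (fun g => diag_conj g h).

Definition generic_automorphisms (m : nat) (M : choiceType) (e : rel M) : Prop :=
  exists h : {ptws 'I_m -> Aut e}, comeagre (diag_orbit h).

Definition ample_generics (M : choiceType) (e : rel M) : Prop :=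
  forall m : nat, (1 <= m)%N -> generic_automorphisms m e.

(* Main.v *)
Require Import Defs.
From mathcomp Require Import all_boot fingroup perm.
From mathcomp Require Import boolp classical_sets functions cardinality.
From mathcomp Require Import topology.

(** A tuple of automorphisms is generic as soon as finite invariant
    substructures that are amalgamation bases are cofinal and every finite
    extension of such a base is realized over it; two generic tuples are then
    conjugate by back-and-forth, and genericity is a countable intersection of
    dense open conditions.

    Amalgamation of finite structures with automorphisms can fail: if an
    automorphism exchanges the two classes into which a new part divides an old
    one, it cannot fix a new vertex of the old part.  It succeeds over a
    structure that contains, in a canonical invariant set, exactly one vertex
    for every possible behaviour of a vertex in one of its parts: mapping a new
    vertex of an old part to the canonical vertex with the same edges is an
    equivariant retraction, and the edges from a new vertex to a new part of the
    other factor can be copied from its retract.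

    Such structures are cofinal because of a strong form of the extension
    property for partial automorphisms.  By the parity condition the edge
    between [x] in [X] and [y] in [Y] is a sum [w_x(Y) + w_y(X) + t(X, Y)].
    Taking as vertices all pairs of a part and a valuation of the parts, a
    partial automorphism extends to a permutation of the parts followed by a
    translation of the valuations.  The parts are themselves enriched by their
    conjectured edges to the original structure, so that the translation is
    well defined. *)

Set Implicit Arguments.
Unset Strict Implicit.
Unset Printing Implicit Defensive.

(** * Parts and parity without a named partition *)

Definition nonadjacent (T : Type) (r : rel T) (x y : T) : bool :=
  ~~ r x y && ~~ r y x.

Definition parity (T : Type) (r : rel T) (a b c d : T) : bool :=
  r a c (+) r a d (+) (r b c (+) r b d).

(** The parts are recovered as the classes of [nonadjacent]. For [a = b], for [c = d] or inside a
    single part the parity condition is trivial. *)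
Record semigeneric (T : Type) (r : rel T) : Prop := Semigeneric {
  sg_irr : forall x, ~~ r x x;
  sg_asym : forall x y, ~~ (r x y && r y x);
  sg_trans : forall x y z,
    nonadjacent r x y -> nonadjacent r y z -> nonadjacent r x z;
  sg_parity : forall a b c d,
    nonadjacent r a b -> nonadjacent r c d -> parity r a b c d = false }.

Section Basics.
Variables (T : Type) (r : rel T).
Hypothesis sg : semigeneric r.

Lemma nonadjacent_refl x : nonadjacent r x x.
Proof. by rewrite /nonadjacent !(sg_irr sg). Qed.

Lemma nonadjacentC x y : nonadjacent r x y = nonadjacent r y x.
Proof. exact: andbC. Qed.

Lemma nonadjacent_edge x y : nonadjacent r x y -> r x y = false.
Proof. by case/andP => /negPf. Qed.

Lemma edge_opp x y : ~~ nonadjacent r x y -> r y x = ~~ r x y.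
Proof.
by have := sg_asym sg x y; rewrite /nonadjacent; case: (r x y); case: (r y x).
Qed.

Lemma nonadjacent_l x y z :
  nonadjacent r x y -> nonadjacent r x z = nonadjacent r y z.
Proof.
move=> xy; apply/idP/idP; first by apply: (sg_trans sg); rewrite nonadjacentC.
exact: (sg_trans sg).
Qed.

Lemma nonadjacent_r x y z :
  nonadjacent r x y -> nonadjacent r z x = nonadjacent r z y.
Proof. by move=> xy; rewrite !(nonadjacentC z); exact: nonadjacent_l. Qed.

Lemma parity_edge a b c d : nonadjacent r a b -> nonadjacent r c d ->
  r a c = r a d (+) r b c (+) r b d.
Proof.
move=> ab cd; have := sg_parity sg ab cd; rewrite /parity.
by case: (r a c); case: (r a d); case: (r b c); case: (r b d).
Qed.

End Basics.

Lemma semigeneric_pullback (T U : Type) (r : rel T) (f : U -> T) :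
  semigeneric r -> semigeneric (fun x y => r (f x) (f y)).
Proof.
move=> sg; split=> [x|x y|x y z|a b c d]; first exact: sg_irr.
- exact: sg_asym.
- exact: (sg_trans sg).
- exact: (sg_parity sg).
Qed.

(** * Amalgamation over saturated systems *)

Section Systems.
Variable m : nat.

Definition system (T : finType) (r : rel T) (f : 'I_m -> T -> T) : Prop :=
  semigeneric r /\
  forall i, injective (f i) /\ forall x y, r (f i x) (f i y) = r x y.

(** The types are arbitrary so that the target can also be the limit with a tuple of
    automorphisms. *)
Definition extension (T U : Type) (r : rel T) (f : 'I_m -> T -> T)
    (s : rel U) (g : 'I_m -> U -> U) (k : T -> U) : Prop :=
  [/\ injective k, forall x y, s (k x) (k y) = r x y
    & forall i x, g i (k x) = k (f i x)].

(* [K] realizes every possible behaviour of a vertex in an existing part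
   exactly once. *)
Definition saturated (T : finType) (r : rel T) (f : 'I_m -> T -> T) : Prop :=
  exists K : pred T,
  [/\ forall i x, K x -> K (f i x),
      forall x y, K x -> K y -> nonadjacent r x y -> r x =1 r y -> x = y
    & forall x t,
        (forall y z, nonadjacent r y z -> t y (+) t z = r x y (+) r x z) ->
        (forall y, nonadjacent r x y -> t y = false) ->
        exists k, [/\ K k, nonadjacent r x k & r k =1 t]].

Lemma system_nonadjacent (T : finType) (r : rel T) f i x y :
  system r f -> nonadjacent r (f i x) (f i y) = nonadjacent r x y.
Proof. by case=> _ /(_ i)[_ rf]; rewrite /nonadjacent !rf. Qed.

Lemma system_surj (T : finType) (r : rel T) f i y :
  system r f -> exists x, y = f i x.
Proof.
by case=> _ /(_ i)[injf _]; exists (finv (f i) y); rewrite f_finv.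
Qed.

(** By parity, the edges from a vertex of an old part to the copy of [T] are a possible behaviour,
    so exactly one vertex of [K] in that part shows them; uniqueness makes the choice equivariant.
    Parts that miss [T] give [None]. *)
Lemma retraction (T U : finType) (r : rel T) f (s : rel U) g (k : T -> U) :
    system r f -> system s g -> saturated r f -> extension r f s g k ->
  exists rho : U -> option T,
  [/\ forall x, rho (k x) = Some x,
      forall u x, rho u = Some x -> nonadjacent s u (k x),
      forall u x, rho u = None -> ~~ nonadjacent s u (k x)
    & forall i u, rho (g i u) = omap (f i) (rho u)].
Proof.
move=> sysT sysU [K [Kf Kuniq Kex]] [injk sk gk].
pose can u x := [&& K x, nonadjacent s u (k x) & [forall y, r x y == s u (k y)]].
(* Base vertices come first: one outside [K] would otherwise be sent to its canonical twin. *)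
pose rho u := if [pick x | k x == u] is Some x then Some x else [pick x | can u x].
have canU u x y : can u x -> can u y -> x = y.
  case/and3P=> Kx ux /forallP rx /and3P[Ky uy /forallP ry].
  apply: Kuniq => //.
    rewrite /nonadjacent -!sk; apply: (sg_trans sysU.1) uy.
    by rewrite nonadjacentC.
  by move=> z; rewrite (eqP (rx z)) (eqP (ry z)).
have canf i u x : can u x -> can (g i u) (f i x).
  case/and3P=> Kx ux /forallP rx; apply/and3P; split; first exact: Kf.
    by rewrite -gk (system_nonadjacent _ _ _ sysU).
  apply/forallP => y; have [z ->] := system_surj i y sysT.
  rewrite -gk; have [_ ->] := sysU.2 i; have [_ ->] := sysT.2 i; exact: rx.
have canN u x : nonadjacent s u (k x) -> exists y, can u y.
  move=> ux; have [|y uy|y [Ky xy ry]] := Kex x (fun y => s u (k y)).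
  - move=> y z yz.
    have yz' : nonadjacent s (k y) (k z) by rewrite /nonadjacent !sk.
    have := sg_parity sysU.1 ux yz'; rewrite /parity !sk.
    by case: (s u _); case: (s u _); case: (r _ _); case: (r _ _).
  - apply: nonadjacent_edge; apply: (sg_trans sysU.1) ux _.
    by rewrite /nonadjacent !sk.
  - exists y; apply/and3P; split => //.
      by apply: (sg_trans sysU.1) ux _; rewrite /nonadjacent !sk.
    by apply/forallP => z; rewrite ry.
have rhok x : rho (k x) = Some x.
  rewrite /rho; case: pickP => [y /eqP/injk-> //|/(_ x)]; by rewrite eqxx.
exists rho; split=> // [u x|u x|i u].
- rewrite /rho; case: pickP => [y /eqP<- [<-]|_]; first exact: (nonadjacent_refl sysU.1).
  by case: pickP => // y /and3P[_ uy _] [<-].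
- rewrite /rho; case: pickP => // _; case: pickP => // Nc _.
  by apply/negP => /canN[y]; rewrite Nc.
(* [u] is a base vertex exactly when [g i u] is, since [f i] is onto; elsewhere uniqueness in [K]
   decides. *)
- rewrite {2}/rho; case: pickP => [x /eqP<-|Nu]; first by rewrite gk rhok.
  rewrite /rho; case: pickP => [y /eqP kyu|_].
    have [x xy] := system_surj i y sysT.
    have := Nu x; move: kyu; rewrite xy -gk => /(sysU.2 i).1 ->.
    by rewrite eqxx.
  case: pickP => [y cy|Nc]; case: pickP => [z cz|Nc'] //=.
  - by congr Some; apply: canU cy (canf _ _ _ cz).
  - have [x xy] := system_surj i y sysT; case/and3P: cy => _ + _.
    by rewrite xy -gk (system_nonadjacent _ _ _ sysU) => /canN[z]; rewrite Nc'.
  - by have := canf i _ _ cz; rewrite Nc.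
Qed.


(** * Edges between the two factors *)

Definition retracts (T U : finType) (f : 'I_m -> T -> T) (s : rel U)
    (g : 'I_m -> U -> U) (k : T -> U) (rho : U -> option T) : Prop :=
  [/\ forall x, rho (k x) = Some x,
      forall u x, rho u = Some x -> nonadjacent s u (k x),
      forall u x, rho u = None -> ~~ nonadjacent s u (k x)
    & forall i u, rho (g i u) = omap (f i) (rho u)].

Section Cross.
Variables (T : finType) (r : rel T) (f : 'I_m -> T -> T).

(* The edge between [u1] and [u2] forced by parity when both of their parts meet
   [T]; if only one does, it is replaced by its retract, and otherwise the
   direction [v] is arbitrary. *)
Definition cross (U1 U2 : finType) (s1 : rel U1) (s2 : rel U2)
    (k1 : T -> U1) (k2 : T -> U2) (rho1 : U1 -> option T)
    (rho2 : U2 -> option T) (v : bool) (u1 : U1) (u2 : U2) : bool :=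
  match rho1 u1, rho2 u2 with
  | Some x, Some y => s2 (k2 x) u2 (+) s1 u1 (k1 y) (+) r x y
  | Some x, None => s2 (k2 x) u2
  | None, Some y => s1 u1 (k1 y)
  | None, None => v
  end.

Section Two.
Variables (U1 U2 : finType) (s1 : rel U1) (s2 : rel U2).
Variables (g1 : 'I_m -> U1 -> U1) (g2 : 'I_m -> U2 -> U2).
Variables (k1 : T -> U1) (k2 : T -> U2).
Variables (rho1 : U1 -> option T) (rho2 : U2 -> option T).
Hypotheses (sysT : system r f) (sys1 : system s1 g1) (sys2 : system s2 g2).
Hypotheses (ext1 : extension r f s1 g1 k1) (ext2 : extension r f s2 g2 k2).
Hypotheses (ret1 : retracts f s1 g1 k1 rho1) (ret2 : retracts f s2 g2 k2 rho2).

Let cr := cross s1 s2 k1 k2 rho1 rho2.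
Let rc := cross s2 s1 k2 k1 rho2 rho1.

Lemma cross_nonadjacent v a b x y : rho1 a = Some x -> rho2 b = Some y ->
  nonadjacent r x y -> cr v a b = false.
Proof.
move=> ax bY xy; rewrite /cr /cross ax bY /= (nonadjacent_edge xy).
have [[_ n1 _ _] [_ n2 _ _]] := (ret1, ret2).
have [[_ e1 _] [_ e2 _]] := (ext1, ext2).
have E2 : nonadjacent s2 (k2 x) b.
  rewrite (nonadjacent_r sys2.1 _ (n2 _ _ bY)) /nonadjacent !e2; exact: xy.
have E1 : nonadjacent s1 a (k1 y).
  rewrite (nonadjacent_l sys1.1 _ (n1 _ _ ax)) /nonadjacent !e1; exact: xy.
by rewrite (nonadjacent_edge E1) (nonadjacent_edge E2).
Qed.

(** In every case the value is a sum of one or three terms, and the exchange of factors negates each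
    of them. *)
Lemma cross_opp v a b :
    (forall x y, rho1 a = Some x -> rho2 b = Some y -> ~~ nonadjacent r x y) ->
  rc (~~ v) b a = ~~ cr v a b.
Proof.
have [[_ n1 N1 _] [_ n2 N2 _]] := (ret1, ret2).
have [[_ e1 _] [_ e2 _]] := (ext1, ext2).
rewrite /rc /cr /cross.
case Ea: (rho1 a) => [x|]; case Eb: (rho2 b) => [y|] Nab //=.
- have Nxy := Nab _ _ erefl erefl.
  have Nb : ~~ nonadjacent s2 (k2 x) b.
    by rewrite (nonadjacent_r sys2.1 _ (n2 _ _ Eb)) /nonadjacent !e2.
  have Na : ~~ nonadjacent s1 a (k1 y).
    by rewrite (nonadjacent_l sys1.1 _ (n1 _ _ Ea)) /nonadjacent !e1.
  rewrite (edge_opp sys1.1 Na) (edge_opp sys2.1 Nb) (edge_opp sysT.1 Nxy).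
  by case: (s1 _ _); case: (s2 _ _); case: (r _ _).
- by rewrite (edge_opp sys2.1) // nonadjacentC N2.
- by rewrite (edge_opp sys1.1) // N1.
Qed.

(** [a] and [a'] have retracts or lack them together, and so do [b] and [b']. The sum then splits
    into sums over [s1], [s2] and [r] that vanish by parity, or is four times [v]. *)
Lemma cross_parity v a a' b b' :
    nonadjacent s1 a a' -> nonadjacent s2 b b' ->
  cr v a b (+) cr v a b' (+) (cr v a' b (+) cr v a' b') = false.
Proof.
have [[_ n1 N1 _] [_ n2 N2 _]] := (ret1, ret2).
have [[_ e1 _] [_ e2 _]] := (ext1, ext2).
move=> aa' bb'; rewrite /cr /cross.
have near1 x : rho1 a = Some x -> exists x', rho1 a' = Some x'.
  case E: (rho1 a') => [x'|] => [_|/n1 ax]; first by exists x'.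
  by have := N1 _ x E; rewrite -(nonadjacent_l sys1.1 _ aa') ax.
have near1' x : rho1 a' = Some x -> exists x', rho1 a = Some x'.
  case E: (rho1 a) => [x'|] => [_|/n1 ax]; first by exists x'.
  by have := N1 _ x E; rewrite (nonadjacent_l sys1.1 _ aa') ax.
have near2 x : rho2 b = Some x -> exists x', rho2 b' = Some x'.
  case E: (rho2 b') => [x'|] => [_|/n2 ax]; first by exists x'.
  by have := N2 _ x E; rewrite -(nonadjacent_l sys2.1 _ bb') ax.
have near2' x : rho2 b' = Some x -> exists x', rho2 b = Some x'.
  case E: (rho2 b) => [x'|] => [_|/n2 ax]; first by exists x'.
  by have := N2 _ x E; rewrite (nonadjacent_l sys2.1 _ bb') ax.
have xx' x x' : rho1 a = Some x -> rho1 a' = Some x' -> nonadjacent r x x'.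
  move=> /n1 ax /n1 ax'; have : nonadjacent s1 (k1 x) (k1 x').
    by rewrite -(nonadjacent_l sys1.1 _ ax) (nonadjacent_l sys1.1 _ aa').
  by rewrite /nonadjacent !e1.
have yy' x x' : rho2 b = Some x -> rho2 b' = Some x' -> nonadjacent r x x'.
  move=> /n2 ax /n2 ax'; have : nonadjacent s2 (k2 x) (k2 x').
    by rewrite -(nonadjacent_l sys2.1 _ ax) (nonadjacent_l sys2.1 _ bb').
  by rewrite /nonadjacent !e2.
have P1 y y' : nonadjacent r y y' ->
    s1 a (k1 y) = s1 a (k1 y') (+) s1 a' (k1 y) (+) s1 a' (k1 y').
  move=> yy; apply: (parity_edge sys1.1 aa'); by rewrite /nonadjacent !e1.
have P2 x x' : nonadjacent r x x' ->
    s2 (k2 x) b = s2 (k2 x) b' (+) s2 (k2 x') b (+) s2 (k2 x') b'.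
  move=> xx; apply: (parity_edge sys2.1 _ bb'); by rewrite /nonadjacent !e2.
case Ea: (rho1 a) => [x|]; last first.
  case Ea': (rho1 a') => [x'|]; first by have [] := near1' _ Ea'; rewrite Ea.
  case Eb: (rho2 b) => [y|]; last first.
    case Eb': (rho2 b') => [y'|]; first by have [] := near2' _ Eb'; rewrite Eb.
    by case: v.
  have [y' Eb'] := near2 _ Eb; rewrite Eb' (P1 _ _ (yy' _ _ Eb Eb')).
  by case: (s1 _ _); case: (s1 _ _); case: (s1 _ _).
have [x' Ea'] := near1 _ Ea; rewrite Ea'.
case Eb: (rho2 b) => [y|]; last first.
  case Eb': (rho2 b') => [y'|]; first by have [] := near2' _ Eb'; rewrite Eb.
  rewrite (P2 _ _ (xx' _ _ Ea Ea')).
  by case: (s2 _ _); case: (s2 _ _); case: (s2 _ _).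
have [y' Eb'] := near2 _ Eb; rewrite Eb' (P1 _ _ (yy' _ _ Eb Eb')).
rewrite (P2 _ _ (xx' _ _ Ea Ea')).
rewrite (parity_edge sysT.1 (xx' _ _ Ea Ea') (yy' _ _ Eb Eb')).
case: (s2 _ _); case: (s2 _ _); case: (s2 _ _); case: (r _ _); case: (r _ _).
all: by case: (r _ _); case: (s1 _ _); case: (s1 _ _); case: (s1 _ _).
Qed.

Lemma cross_equivariant v i a b : cr v (g1 i a) (g2 i b) = cr v a b.
Proof.
have [[_ _ _ q1] [_ _ _ q2]] := (ret1, ret2).
have [[_ _ c1] [_ _ c2]] := (ext1, ext2).
rewrite /cr /cross q1 q2; case: (rho1 a) => [x|]; case: (rho2 b) => [y|] //=.
- by rewrite -c1 -c2 !(sys1.2 i).2 !(sys2.2 i).2 !(sysT.2 i).2.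
- by rewrite -c2 !(sys2.2 i).2.
- by rewrite -c1 !(sys1.2 i).2.
Qed.

(** The terms [s1 (k1 x) (k1 y)] and [r x y] cancel. This makes [k1 x] and [k2 x] twins in the
    amalgam. *)
Lemma cross_base v x b : cr v (k1 x) b = s2 (k2 x) b.
Proof.
have [q1 _ _ _] := ret1; have [_ e1 _] := ext1.
rewrite /cr /cross q1; case: (rho2 b) => [y|] //.
by rewrite e1 -addbA addbb addbF.
Qed.

Lemma cross_base_r v a y : cr v a (k2 y) = s1 a (k1 y).
Proof.
have [q2 _ _ _] := ret2; have [_ e2 _] := ext2.
rewrite /cr /cross q2; case: (rho1 a) => [x|] //.
by rewrite e2 addbC addbA addbb addFb.
Qed.

End Two.
End Cross.

End Systems.

(** * The amalgam of two extensions *)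

Section Amalgam.
Variable m : nat.
Variables (T U1 U2 : finType) (r : rel T) (s1 : rel U1) (s2 : rel U2).
Variables (f : 'I_m -> T -> T).
Variables (g1 : 'I_m -> U1 -> U1) (g2 : 'I_m -> U2 -> U2).
Variables (k1 : T -> U1) (k2 : T -> U2).
Variables (rho1 : U1 -> option T) (rho2 : U2 -> option T).
Hypotheses (sysT : system r f) (sys1 : system s1 g1) (sys2 : system s2 g2).
Hypotheses (ext1 : extension r f s1 g1 k1) (ext2 : extension r f s2 g2 k2).
Hypotheses (ret1 : retracts f s1 g1 k1 rho1) (ret2 : retracts f s2 g2 k2 rho2).

(* The two copies of [T] are kept apart: corresponding vertices are twins. *)
Definition amalgam : rel (U1 + U2) := fun z w =>
  match z, w with
  | inl a, inl b => s1 a b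
  | inr a, inr b => s2 a b
  | inl a, inr b => cross r s1 s2 k1 k2 rho1 rho2 true a b
  | inr a, inl b => cross r s2 s1 k2 k1 rho2 rho1 false a b
  end.

Let rho (z : U1 + U2) := match z with inl a => rho1 a | inr b => rho2 b end.

Let side (z : U1 + U2) := if z is inl _ then true else false.

Let amalgam_near z w x y : rho z = Some x -> rho w = Some y ->
  nonadjacent amalgam z w = nonadjacent r x y.
Proof.
have [[_ n1 _ _] [_ n2 _ _]] := (ret1, ret2).
have [[_ e1 _] [_ e2 _]] := (ext1, ext2).
case: z w => [a|a] [b|b] /= Ea Eb.
- rewrite -[LHS]/(nonadjacent s1 a b) (nonadjacent_l sys1.1 _ (n1 _ _ Ea)).
  by rewrite (nonadjacent_r sys1.1 _ (n1 _ _ Eb)) /nonadjacent !e1.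
- have [xy|Nxy] := boolP (nonadjacent r x y).
    have yx : nonadjacent r y x by rewrite nonadjacentC.
    rewrite /nonadjacent /= (cross_nonadjacent sys1 sys2 ext1 ext2 ret1 ret2 _ Ea Eb xy).
    by rewrite (cross_nonadjacent sys2 sys1 ext2 ext1 ret2 ret1 _ Eb Ea yx).
  rewrite /nonadjacent /= (cross_opp sysT sys1 sys2 ext1 ext2 ret1 ret2 true).
    by case: cross.
  by move=> x' y'; rewrite Ea Eb => -[<-] [<-].
- have [xy|Nxy] := boolP (nonadjacent r x y).
    have yx : nonadjacent r y x by rewrite nonadjacentC.
    rewrite /nonadjacent /= (cross_nonadjacent sys1 sys2 ext1 ext2 ret1 ret2 _ Eb Ea yx).
    by rewrite (cross_nonadjacent sys2 sys1 ext2 ext1 ret2 ret1 _ Ea Eb xy).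
  rewrite /nonadjacent /= (cross_opp sysT sys1 sys2 ext1 ext2 ret1 ret2 true).
    by case: cross.
  by move=> x' y'; rewrite Ea Eb nonadjacentC => -[<-] [<-].
- rewrite -[LHS]/(nonadjacent s2 a b) (nonadjacent_l sys2.1 _ (n2 _ _ Ea)).
  by rewrite (nonadjacent_r sys2.1 _ (n2 _ _ Eb)) /nonadjacent !e2.
Qed.

Let amalgam_opp a b : (rho1 a = None) + (rho2 b = None) ->
  amalgam (inr b) (inl a) = ~~ amalgam (inl a) (inr b).
Proof.
move=> ab /=.
rewrite -(cross_opp sysT sys1 sys2 ext1 ext2 ret1 ret2) // => x y.
by case: ab => ->.
Qed.

(** A vertex of a new part is joined to every vertex of the other factor, so a new part stays on its
    side. *)
Let amalgam_far z w : rho z = None -> nonadjacent amalgam z w ->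
  rho w = None /\ side z = side w.
Proof.
have [[_ n1 N1 _] [_ n2 N2 _]] := (ret1, ret2).
case: z w => [a|a] [b|b] /= Ea zw.
- case Eb: (rho1 b) => [y|] //; have /= := N1 _ y Ea.
  by rewrite -(nonadjacent_r sys1.1 _ (n1 _ _ Eb)) [nonadjacent _ _ _]zw.
- have := amalgam_opp (inl Ea : (_ + (rho2 b = _))%type).
  by move: zw; rewrite /nonadjacent => /andP[/negPf-> /negPf->].
- have := amalgam_opp (inr Ea : ((rho1 b = _) + _)%type).
  by move: zw; rewrite /nonadjacent => /andP[/negPf-> /negPf->].
- case Eb: (rho2 b) => [y|] //; have /= := N2 _ y Ea.
  by rewrite -(nonadjacent_r sys2.1 _ (n2 _ _ Eb)) [nonadjacent _ _ _]zw.
Qed.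

Let amalgam_trans z w v :
  nonadjacent amalgam z w -> nonadjacent amalgam w v -> nonadjacent amalgam z v.
Proof.
case Ez: (rho z) => [x|] zw wv; last first.
  have [Ew zsw] := amalgam_far Ez zw; have [Ev wsv] := amalgam_far Ew wv.
  case: z w v zsw wsv zw wv {Ez Ew Ev} => [a|a] [b|b] [c|c] //= _ _.
    exact: (sg_trans sys1.1).
  exact: (sg_trans sys2.1).
case Ew: (rho w) => [y|]; last first.
  by have [] := amalgam_far Ew (_ : nonadjacent _ _ z); rewrite ?Ez // nonadjacentC.
case Ev: (rho v) => [t|]; last first.
  by have [] := amalgam_far Ev (_ : nonadjacent _ _ w); rewrite ?Ew // nonadjacentC.
rewrite (amalgam_near Ez Ev); apply: (sg_trans sysT.1 (y := y)).
  by rewrite -(amalgam_near Ez Ew).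
by rewrite -(amalgam_near Ew Ev).
Qed.

Let amalgam_twin_l x w : amalgam (inl (k1 x)) w = amalgam (inr (k2 x)) w.
Proof.
case: w => w /=; last by rewrite (cross_base s2 k2 rho2 ext1 ret1).
by rewrite (cross_base s1 k1 rho1 ext2 ret2).
Qed.

Let amalgam_twin_r x w : amalgam w (inl (k1 x)) = amalgam w (inr (k2 x)).
Proof.
case: w => w /=; last by rewrite (cross_base_r s2 k2 rho2 ext1 ret1).
by rewrite (cross_base_r s1 k1 rho1 ext2 ret2).
Qed.

Let amalgam_parity_side z z' w w' : side z = side z' -> side w = side w' ->
  nonadjacent amalgam z z' -> nonadjacent amalgam w w' ->
  parity amalgam z z' w w' = false.
Proof.
case: z z' w w' => [a|a] [a'|a'] [b|b] [b'|b'] //= _ _ aa' bb'.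
- exact: (sg_parity sys1.1).
- exact: (cross_parity sysT sys1 sys2 ext1 ext2 ret1 ret2).
- exact: (cross_parity sysT sys2 sys1 ext2 ext1 ret2 ret1).
- exact: (sg_parity sys2.1).
Qed.

(** Additivity lets a pair be replaced by a chain of links that are easier to control. *)
Let parity_split z z' v w w' :
  parity amalgam z z' w w' = parity amalgam z v w w' (+) parity amalgam v z' w w'.
Proof.
rewrite /parity; move: (amalgam z w) (amalgam z w') (amalgam v w) (amalgam v w').
by do 4!case; case: (amalgam z' w); case: (amalgam z' w').
Qed.

Let parity_split_r z z' v w w' :
  parity amalgam z z' w w' = parity amalgam z z' w v (+) parity amalgam z z' v w'.
Proof.
rewrite /parity; move: (amalgam z w) (amalgam z w') (amalgam z v) (amalgam z' v).
by do 4!case; case: (amalgam z' w); case: (amalgam z' w').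
Qed.

(* A pair of vertices of one part on different sides can be linked through a
   pair of twins. *)
Let amalgam_link a b : nonadjacent amalgam (inl a) (inr b) ->
  exists x, nonadjacent amalgam (inl a) (inl (k1 x))
         /\ nonadjacent amalgam (inr (k2 x)) (inr b).
Proof.
have [[q1 n1 _ _] [q2 n2 _ _]] := (ret1, ret2).
move=> ab; case Ea: (rho1 a) => [x|]; last first.
  by have [//] := amalgam_far (Ea : rho (inl a) = None) ab.
exists x; have ax : nonadjacent amalgam (inl a) (inl (k1 x)) by exact: n1.
split=> //; rewrite /nonadjacent -amalgam_twin_l -amalgam_twin_r.
by apply: amalgam_trans ab; rewrite nonadjacentC.
Qed.

(** A pair on different sides is linked through [inl (k1 x)] and [inr (k2 x)]: the outer links stay
    on one side, and the middle one contributes nothing because twins have the same edges. *)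
Let amalgam_parity_l z z' w w' : side w = side w' ->
  nonadjacent amalgam z z' -> nonadjacent amalgam w w' ->
  parity amalgam z z' w w' = false.
Proof.
have twin x : parity amalgam (inl (k1 x)) (inr (k2 x)) w w' = false.
  by rewrite /parity !amalgam_twin_l addbb.
case: z z' => [a|a] [a'|a'] sw zz' ww'; try exact: amalgam_parity_side.
- have [x [ax xb]] := amalgam_link zz'.
  rewrite (parity_split _ _ (inl (k1 x))) amalgam_parity_side //.
  by rewrite (parity_split _ _ (inr (k2 x))) twin amalgam_parity_side.
- rewrite nonadjacentC in zz'; have [x [ax xb]] := amalgam_link zz'.
  have -> : parity amalgam (inr a) (inl a') w w' =
            parity amalgam (inl a') (inr a) w w'.
    by rewrite /parity addbC.
  rewrite (parity_split _ _ (inl (k1 x))) amalgam_parity_side //.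
  by rewrite (parity_split _ _ (inr (k2 x))) twin amalgam_parity_side.
Qed.

Let amalgam_parity z z' w w' :
  nonadjacent amalgam z z' -> nonadjacent amalgam w w' ->
  parity amalgam z z' w w' = false.
Proof.
have twin x : parity amalgam z z' (inl (k1 x)) (inr (k2 x)) = false.
  by rewrite /parity !amalgam_twin_r !addbb.
case: w w' => [a|a] [a'|a'] zz' ww'; try exact: amalgam_parity_l.
- have [x [ax xb]] := amalgam_link ww'.
  rewrite (parity_split_r _ _ (inl (k1 x))) amalgam_parity_l //.
  by rewrite (parity_split_r _ _ (inr (k2 x))) twin amalgam_parity_l.
- rewrite nonadjacentC in ww'; have [x [ax xb]] := amalgam_link ww'.
  have -> : parity amalgam z z' (inr a) (inl a') =
            parity amalgam z z' (inl a') (inr a).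
    by rewrite /parity (addbC (amalgam z _)) (addbC (amalgam z' _)).
  rewrite (parity_split_r _ _ (inl (k1 x))) amalgam_parity_l //.
  by rewrite (parity_split_r _ _ (inr (k2 x))) twin amalgam_parity_l.
Qed.

Lemma amalgam_semigeneric : semigeneric amalgam.
Proof.
split; [| |exact: amalgam_trans|exact: amalgam_parity].
  by case=> a /=; [exact: sg_irr sys1.1 _|exact: sg_irr sys2.1 _].
have mixed a b : ~~ (amalgam (inl a) (inr b) && amalgam (inr b) (inl a)).
  case Ea: (rho1 a) => [x|].
    case Eb: (rho2 b) => [y|]; last by rewrite amalgam_opp ?andbN //; right.
    have [xy|Nxy] := boolP (nonadjacent r x y).
      by rewrite -(amalgam_near (z := inl a) (w := inr b) Ea Eb) in xy;
        rewrite (nonadjacent_edge xy).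
    rewrite /= (cross_opp sysT sys1 sys2 ext1 ext2 ret1 ret2 true) ?andbN //.
    by move=> x' y'; rewrite Ea Eb => -[<-] [<-].
  by rewrite amalgam_opp ?andbN //; left.
by case=> a [] b; rewrite ?mixed 1?andbC ?mixed //;
  [exact: sg_asym sys1.1 _ _|exact: sg_asym sys2.1 _ _].
Qed.

Definition amalgam_act (i : 'I_m) (z : U1 + U2) : U1 + U2 :=
  match z with inl a => inl (g1 i a) | inr b => inr (g2 i b) end.

Lemma amalgam_system : system amalgam amalgam_act.
Proof.
split=> [|i]; first exact: amalgam_semigeneric.
split=> [[a|a] [b|b] //= [] /=|[a|a] [b|b] /=].
- by move/(sys1.2 i).1 ->.
- by move/(sys2.2 i).1 ->.
- exact: (sys1.2 i).2.
- exact: (cross_equivariant sysT sys1 sys2 ext1 ext2 ret1 ret2).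
- exact: (cross_equivariant sysT sys2 sys1 ext2 ext1 ret2 ret1).
- exact: (sys2.2 i).2.
Qed.

Lemma amalgam_inl : extension s1 g1 amalgam amalgam_act inl.
Proof. by split=> // a b []. Qed.

(** Base vertices are sent to their [inl] copy, so that both embeddings agree on [T]; edges are kept
    because the copies are twins. *)
Definition amalgam_inr (b : U2) : U1 + U2 :=
  if [pick x | k2 x == b] is Some x then inl (k1 x) else inr b.

Lemma amalgam_inr_base x : amalgam_inr (k2 x) = inl (k1 x).
Proof.
have [inj2 _ _] := ext2; rewrite /amalgam_inr.
by case: pickP => [y /eqP/inj2->|/(_ x)] //; rewrite eqxx.
Qed.

Let amalgam_inr_l b z : amalgam (amalgam_inr b) z = amalgam (inr b) z.
Proof.
rewrite /amalgam_inr; case: pickP => [x /eqP<-|//]; exact: amalgam_twin_l.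
Qed.

Let amalgam_inr_r b z : amalgam z (amalgam_inr b) = amalgam z (inr b).
Proof.
rewrite /amalgam_inr; case: pickP => [x /eqP<-|//]; exact: amalgam_twin_r.
Qed.

Lemma amalgam_inrP : extension s2 g2 amalgam amalgam_act amalgam_inr.
Proof.
have [[inj1 _ c1] [inj2 _ c2]] := (ext1, ext2).
split=> [b b'|b b'|i b].
- rewrite /amalgam_inr; case: pickP => [x /eqP<-|_]; case: pickP => [y /eqP<-|_].
  + by case=> /inj1->.
  + by [].
  + by [].
  + by case.
- by rewrite amalgam_inr_l amalgam_inr_r.
- rewrite {1}/amalgam_inr; case: pickP => [x /eqP<-|Nb] /=.
    by rewrite c1 c2 amalgam_inr_base.
  rewrite /amalgam_inr; case: pickP => // x /eqP xb.
  have [y xy] := system_surj i x sysT; move: xb; rewrite xy -c2.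
  by move/(sys2.2 i).1 => yb; have := Nb y; rewrite yb eqxx.
Qed.

End Amalgam.

Lemma saturated_amalgamation (m : nat) (T U1 U2 : finType)
    (r : rel T) (f : 'I_m -> T -> T) (s1 : rel U1) (g1 : 'I_m -> U1 -> U1)
    (s2 : rel U2) (g2 : 'I_m -> U2 -> U2) (k1 : T -> U1) (k2 : T -> U2) :
    system r f -> saturated r f -> system s1 g1 -> system s2 g2 ->
    extension r f s1 g1 k1 -> extension r f s2 g2 k2 ->
  exists (W : finType) (q : rel W) (h : 'I_m -> W -> W)
    (j1 : U1 -> W) (j2 : U2 -> W),
  [/\ system q h, extension s1 g1 q h j1, extension s2 g2 q h j2
    & forall x, j2 (k2 x) = j1 (k1 x)].
Proof.
move=> sysT satT sys1 sys2 ext1 ext2.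
have [rho1 ret1] := retraction sysT sys1 satT ext1.
have [rho2 ret2] := retraction sysT sys2 satT ext2.
exists (U1 + U2)%type, (amalgam r s1 s2 k1 k2 rho1 rho2), (amalgam_act g1 g2).
exists inl, (amalgam_inr k1 k2); split.
- exact: amalgam_system sysT sys1 sys2 ext1 ext2 ret1 ret2.
- exact: amalgam_inl.
- exact: amalgam_inrP sysT sys2 ext1 ext2 ret1 ret2.
- exact: amalgam_inr_base _ ext2.
Qed.

(** * The extension property for partial automorphisms *)

(** Sending [a x] to [b x] is a well-defined bijection between the two images of [D]; their
    complements have equal size and are matched in the order of enumeration. *)
Lemma perm_extend (X Y : finType) (D : pred X) (a b : X -> Y) :
    (forall x y, D x -> D y -> (a x == a y) = (b x == b y)) ->
  exists s : {perm Y}, forall x, D x -> s (a x) = b x.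
Proof.
move=> ab; pose A := [set a x | x in D]; pose B := [set b x | x in D].
pose c y := if [pick x | D x && (a x == y)] is Some x then b x else y.
have ca x : D x -> c (a x) = b x.
  move=> Dx; rewrite /c; case: pickP => [z /andP[Dz]|/(_ x)]; last by rewrite Dx eqxx.
  by rewrite ab // => /eqP.
have cB : c @: A = B.
  apply/setP => y; apply/imsetP/imsetP => [[_ /imsetP[x Dx ->] ->]|[x Dx ->]].
    by exists x; rewrite ?ca.
  by exists (a x); rewrite ?ca //; apply: imset_f.
have c_inj : {in A &, injective c}.
  move=> _ _ /imsetP[x Dx ->] /imsetP[y Dy ->]; rewrite !ca // => /eqP.
  by rewrite -ab // => /eqP.
have cardC : #|~: A| = #|~: B|.
  by apply/eqP; rewrite -(eqn_add2l #|A|) cardsC -{1}(card_in_imset c_inj) cB cardsC.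
pose q y := if y \in A then c y else nth y (enum (~: B)) (index y (enum (~: A))).
have szE y : y \notin A -> index y (enum (~: A)) < size (enum (~: B)).
  by move=> yA; rewrite -cardE -cardC cardE index_mem mem_enum inE.
have qN y : y \notin A -> q y \notin B.
  move=> yA; rewrite /q (negPf yA).
  have := mem_nth y (szE y yA); by rewrite mem_enum inE.
have qA y : y \in A -> q y \in B by move=> yA; rewrite /q yA -cB imset_f.
have q_inj : injective q.
  move=> y z; case: (boolP (y \in A)) => yA; case: (boolP (z \in A)) => zA qyz.
  - by move: qyz; rewrite /q yA zA; apply: c_inj.
  - by have := qN z zA; rewrite -qyz qA.
  - by have := qN y yA; rewrite qyz qA.
  - move: qyz; rewrite /q (negPf yA) (negPf zA) (set_nth_default z) ?szE //.
    move/eqP; rewrite nth_uniq ?szE ?enum_uniq // => /eqP yz.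
    rewrite -(nth_index y (s := enum (~: A)) (x := y)) ?mem_enum ?inE // yz.
    by rewrite nth_index // mem_enum inE.
exists (perm q_inj) => x Dx; rewrite permE /q ifT ?ca //; exact: imset_f.
Qed.

(** * A universal structure of parts and valuations *)

Section Valuations.
Variables (T : finType) (r : rel T).
Hypothesis sg : semigeneric r.

Definition part_rep (x : T) : T := odflt x [pick y | nonadjacent r x y].

Lemma part_repP x : nonadjacent r x (part_rep x).
Proof.
rewrite /part_rep; case: pickP => [//|_]; exact: nonadjacent_refl sg _.
Qed.

(** [pick] agrees on extensionally equal predicates, so the representative depends only on the
    part. *)
Lemma eq_part_rep x y : (part_rep x == part_rep y) = nonadjacent r x y.
Proof.
apply/eqP/idP => [xy|xy].
  apply: (sg_trans sg (part_repP x)); rewrite xy nonadjacentC; exact: part_repP.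
rewrite /part_rep.
have E : nonadjacent r x =1 nonadjacent r y by move=> z; apply: (nonadjacent_l sg).
rewrite (eq_pick E); case: pickP => [//|/(_ y)].
by rewrite (nonadjacent_refl sg).
Qed.

(* A part of the universal structure consists of a part of [T], given by its
   representative, and a guess, up to a constant on every part, of its edges
   to [T]. *)
Definition vpart : finType := (T * {ffun T -> bool})%type.

(** The [option T] label keeps the image of [T] apart from the vertices labelled [None], among which
    the canonical ones are chosen; edges ignore it. *)
Definition vertex : finType := (vpart * option T * {ffun vpart -> bool})%type.

(** Ranks break the tie between parts over the same part of [T]. The reversed direction [r Q.1 P.1]
    is the term that parity produces in [vertex_of_edge]. *)
Definition vorder (P Q : vpart) : bool :=
  if nonadjacent r P.1 Q.1 then enum_rank P < enum_rank Q else r Q.1 P.1.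

(* A vertex carries a valuation [w] of all parts; an edge is the sum of the
   two relevant values, corrected by the antisymmetric [vorder]. *)
Definition vedge : rel vertex := fun a b =>
  (a.1.1 != b.1.1) && (a.2 b.1.1 (+) b.2 a.1.1 (+) vorder a.1.1 b.1.1).

Definition vpart_of (x : T) : vpart :=
  (part_rep x, [ffun y => r (part_rep x) y]).

(** The value at [Q] is the edge to [x] that [Q] guesses. It is thus fixed at all parts, also at
    those not of the form [vpart_of y]. *)
Definition vertex_of (x : T) : vertex :=
  (vpart_of x, Some x, [ffun Q : vpart => Q.2 x]).

Lemma vorderC P Q : P != Q -> vorder Q P = ~~ vorder P Q.
Proof.
move=> PQ; rewrite /vorder nonadjacentC; case: ifPn => [_|N]; last first.
  by rewrite (edge_opp sg N) negbK.
rewrite -leqNgt ltn_neqAle; have -> // : enum_rank Q != enum_rank P :> nat.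
by apply: contraNneq PQ => E; apply/eqP/esym/enum_rank_inj/val_inj.
Qed.

Lemma vedge_opp a b : a.1.1 != b.1.1 -> vedge b a = ~~ vedge a b.
Proof.
move=> ab; rewrite /vedge eq_sym ab (vorderC ab) /=.
by case: (a.2 _); case: (b.2 _); case: vorder.
Qed.

Lemma vedge_nonadjacent a b : nonadjacent vedge a b = (a.1.1 == b.1.1).
Proof.
rewrite /nonadjacent; have [E|ab] := eqVneq a.1.1 b.1.1.
  by rewrite /vedge E eqxx.
by rewrite (vedge_opp ab); case: vedge.
Qed.

Lemma vedge_semigeneric : semigeneric vedge.
Proof.
split=> [a|a b|a b c|a b c d]; first by rewrite /vedge eqxx.
- have [E|ab] := eqVneq a.1.1 b.1.1; first by rewrite /vedge E eqxx.
  by rewrite (vedge_opp ab) andbN.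
- by rewrite !vedge_nonadjacent => /eqP->.
- rewrite !vedge_nonadjacent /parity /vedge => /eqP-> /eqP->.
  case: (_ != _) => //=; case: (a.2 _); case: (b.2 _); case: (c.2 _).
  all: by case: (d.2 _); case: (vorder _ _).
Qed.

Lemma vpart_of_eq x y : (vpart_of x == vpart_of y) = nonadjacent r x y.
Proof.
rewrite -eq_part_rep; apply/eqP/eqP => [[]//|E]; by rewrite /vpart_of E.
Qed.

(** Parity for [x], [y] and their representatives expresses [r x y] as the three terms that [vedge]
    adds. *)
Lemma vertex_of_edge x y : vedge (vertex_of x) (vertex_of y) = r x y.
Proof.
rewrite /vedge /= vpart_of_eq !ffunE /=.
have [xy|Nxy] := boolP (nonadjacent r x y); first by rewrite (nonadjacent_edge xy).
have Nrep : ~~ nonadjacent r (part_rep x) (part_rep y).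
  by rewrite -(nonadjacent_l sg _ (part_repP x)) -(nonadjacent_r sg _ (part_repP y)).
rewrite /vorder /= (negPf Nrep).
have := sg_parity sg (part_repP y) (part_repP x); rewrite /parity (edge_opp sg Nxy).
have -> : r y (part_rep x) = ~~ r (part_rep x) y.
  by apply: (edge_opp sg); rewrite -(nonadjacent_l sg _ (part_repP x)).
by case: (r x y); case: (r _ _); case: (r _ _); case: (r _ _).
Qed.

Lemma vertex_of_inj : injective vertex_of.
Proof. by move=> x y []. Qed.

(** Edges do not see the value of a valuation at its own part; fixing it and the label leaves one
    vertex for each behaviour. *)
Definition vcanonical : pred vertex := fun a =>
  (a.1.2 == None) && ~~ a.2 a.1.1.

Lemma vcanonical_uniq a b : vcanonical a -> vcanonical b ->
  nonadjacent vedge a b -> vedge a =1 vedge b -> a = b.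
Proof.
case: a b => [[P ?] v] [[Q ?] w] /andP[/eqP /= -> vP] /andP[/eqP /= -> wQ].
rewrite vedge_nonadjacent /= => /eqP E; subst Q => vw.
congr (_, _); apply/ffunP => Q; have [->|PQ] := eqVneq Q P.
  by rewrite (negPf vP) (negPf wQ).
(* The vertex of [Q] with zero valuation tests the value at [Q]. *)
have := vw (Q, None, [ffun => false]).
rewrite /vedge /= eq_sym PQ /= !ffunE !addbF.
by case: (v Q); case: (w Q); case: vorder.
Qed.

Lemma vcanonical_ex a t :
    (forall b c, nonadjacent vedge b c ->
      t b (+) t c = vedge a b (+) vedge a c) ->
    (forall b, nonadjacent vedge a b -> t b = false) ->
  exists k, [/\ vcanonical k, nonadjacent vedge a k & vedge k =1 t].
Proof.
move=> tpar tpart.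
(* The values are read off from [t] at the vertices with zero valuation; parity then determines [t]
   on the rest of each part. *)
pose w := [ffun Q : vpart => (Q != a.1.1) &&
  (t (Q, None, [ffun => false]) (+) vorder a.1.1 Q)].
exists (a.1.1, None, w); split; first by rewrite /vcanonical /= ffunE eqxx.
  by rewrite vedge_nonadjacent.
move=> b; have [E|Pb] := eqVneq a.1.1 b.1.1.
  by rewrite tpart ?vedge_nonadjacent ?E // /vedge /= eqxx.
have := tpar b (b.1.1, None, [ffun => false]).
rewrite vedge_nonadjacent eqxx => /(_ isT).
rewrite /vedge /= Pb !ffunE eq_sym Pb /=.
case: (t b); case: (t _); case: (a.2 _); case: (b.2 _); case: vorder => //.
Qed.

Section Extend.
Variables (D : pred T) (p : T -> T).
Hypothesis p_inj : {in D &, injective p}.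
Hypothesis p_edge : {in D &, forall x y, r (p x) (p y) = r x y}.

(** [F] permutes the parts by [piQ] and adds [th Q] to the valuations of the vertices in part [Q].
    Since [th Q Q] is [false], canonical vertices stay canonical. *)
Lemma vextend : exists F : vertex -> vertex,
  [/\ injective F, forall a b, vedge (F a) (F b) = vedge a b,
      forall a, vcanonical a -> vcanonical (F a)
    & forall x, D x -> F (vertex_of x) = vertex_of (p x)].
Proof.
have p_nonadj x y : D x -> D y -> nonadjacent r (p x) (p y) = nonadjacent r x y.
  by move=> Dx Dy; rewrite /nonadjacent !p_edge.
have [s sP] : exists s : {perm T}, forall x, D x -> s x = p x.
  have [|s sP] := @perm_extend T T D id p; last by exists s.
  by move=> x y Dx Dy /=; rewrite (inj_in_eq p_inj).
have [pi piP] : exists pi : {perm T},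
    forall x, D x -> pi (part_rep x) = part_rep (p x).
  by apply: perm_extend => x y Dx Dy; rewrite !eq_part_rep p_nonadj.
(* The representatives need not follow [p]: [u Y v] is the change of the edge from [Y] to [v] under
   [pi] and [s], and [false] unless [Y] represents a part meeting [D]. *)
pose u Y v := [exists x, D x && (part_rep x == Y)] && (r Y v (+) r (pi Y) (s v)).
have uE x v : D x -> u (part_rep x) v = r (part_rep x) v (+) r (part_rep (p x)) (s v).
  move=> Dx; rewrite /u -piP //; case: existsP => // -[].
  by exists x; rewrite Dx eqxx.
(* Parity before and after [p] makes [u Y] constant on the vertices of [D] in one part, so the
   translation prescribed there is well defined. *)
have u_const x y Y : D x -> D y -> nonadjacent r x y -> u Y x = u Y y.
  move=> Dx Dy xy; rewrite /u; case: existsP => //= -[z /andP[Dz /eqP<-]].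
  rewrite piP // !sP //.
  have pxy : nonadjacent r (p x) (p y) by rewrite p_nonadj.
  have E1 := sg_parity sg (part_repP z) xy.
  have E2 := sg_parity sg (part_repP (p z)) pxy.
  move: E1 E2; rewrite /parity !p_edge //.
  move: (r z x) (r z y) (r (part_rep z) x) (r (part_rep z) y).
  by move: (r (part_rep (p z)) (p x)) (r (part_rep (p z)) (p y)); do 6!case.
have u_own x : D x -> u (part_rep x) x = false.
  move=> Dx; rewrite uE // sP //.
  have E y : r (part_rep y) y = false.
    by apply: nonadjacent_edge; rewrite nonadjacentC part_repP.
  by rewrite !E.
(* The guess is corrected by [u] so that [vpart_of x] goes to [vpart_of (p x)] for [x] in [D]. *)
pose piQ0 (Q : vpart) : vpart :=
  (pi Q.1, [ffun v => Q.2 ((s^-1)%g v) (+) u Q.1 ((s^-1)%g v)]).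
have piQ0_inj : injective piQ0.
  move=> [Y g] [Z h] [/= /perm_inj E /ffunP gh]; subst Z; congr (_, _).
  apply/ffunP => v; have := gh (s v); rewrite !ffunE permK.
  by case: (g v); case: (h v); case: (u Y v).
pose piQ := perm piQ0_inj.
have piQE Q : piQ Q = piQ0 Q by rewrite permE.
have piQP x : D x -> piQ (vpart_of x) = vpart_of (p x).
  move=> Dx; rewrite piQE /piQ0 /vpart_of /= piP //; congr (_, _).
  apply/ffunP => v; rewrite !ffunE uE // permKV.
  by case: (r _ ((s^-1)%g v)); case: (r _ v).
pose has Q := [exists x, D x && (vpart_of x == Q)].
pose th0 Q (Q' : vpart) :=
  if [pick x | D x && (vpart_of x == Q)] is Some x then u Q'.1 x else false.
have th0E x Q : D x -> th0 (vpart_of x) Q = u Q.1 x.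
  move=> Dx; rewrite /th0; case: pickP => [y /andP[Dy]|/(_ x)]; last first.
    by rewrite Dx eqxx.
  by rewrite vpart_of_eq => yx; apply: u_const.
(* Edges are preserved if the translations at their two ends add up to this change of [vorder]. *)
pose delta Q Q' := vorder Q Q' (+) vorder (piQ Q) (piQ Q').
have deltaC Q Q' : Q != Q' -> delta Q' Q = delta Q Q'.
  move=> QQ; rewrite /delta (vorderC QQ) (@vorderC (piQ Q)) ?(inj_eq perm_inj) //.
  by case: vorder; case: vorder.
(* Parts meeting [D] have a prescribed translation. Otherwise the free end absorbs [delta], and of
   two free ends the one of smaller rank does. *)
pose th Q Q' := if Q == Q' then false else if has Q then th0 Q Q' else
  if has Q' then th0 Q' Q (+) delta Q Q' else
  (enum_rank Q < enum_rank Q') && delta Q Q'.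
have thP Q Q' : Q != Q' -> th Q Q' (+) th Q' Q = delta Q Q'.
  move=> QQ; rewrite /th (eq_sym Q' Q) (negPf QQ) (deltaC _ _ QQ).
  case: ifP => [/existsP[x /andP[Dx /eqP E]]|_]; last first.
    case: ifP => _; first by case: (th0 _ _); case: (delta _ _).
    case: ltngtP => // [_|E]; first by rewrite addbF.
    by move: QQ; rewrite (enum_rank_inj (val_inj E)) eqxx.
  case: ifP => [/existsP[y /andP[Dy /eqP E']]|_]; last by rewrite addKb.
  rewrite -E -E' !th0E //=; rewrite -E -E' in QQ.
  rewrite /delta !piQP // uE // uE // !sP //.
  (* With both ends prescribed, the sum is right because [p] preserves the edge between [x] and
     [y]. *)
  have := p_edge Dx Dy; rewrite -(vertex_of_edge (p x)) -(vertex_of_edge x).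
  have QQ' : vpart_of (p x) != vpart_of (p y) by rewrite -!piQP // (inj_eq perm_inj).
  rewrite /vedge /= QQ QQ' !ffunE /=.
  by do 4!case: (r _ _); do 2!case: vorder.
have thU x Q : D x -> th (vpart_of x) Q = u Q.1 x.
  move=> Dx; rewrite /th; case: eqP => [<-|_]; first by rewrite /= u_own.
  case: ifP => [_|/existsP[]]; first exact: th0E.
  by exists x; rewrite Dx eqxx.
pose F (a : vertex) : vertex := (piQ a.1.1, omap s a.1.2,
  [ffun Q => a.2 ((piQ^-1)%g Q) (+) th a.1.1 ((piQ^-1)%g Q)]).
exists F; split.
- move=> [[P x] v] [[Q y] w] [/= /perm_inj E E' /ffunP vw]; subst Q.
  congr (_, _, _).
    by case: x y E' => [x|] [y|] //= [/perm_inj->].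
  apply/ffunP => Q; have := vw (piQ Q); rewrite !ffunE permK.
  by case: (v Q); case: (w Q); case: (th P Q).
- move=> a b; rewrite /vedge /= (inj_eq perm_inj) !ffunE !permK.
  case: (eqVneq a.1.1 b.1.1) => //= ab; have := thP _ _ ab; rewrite /delta.
  move: (th _ _) (th _ _) (vorder _ _) (vorder _ _) (a.2 _) (b.2 _).
  by do 6!case.
- move=> a /andP[/eqP a0 aw]; rewrite /vcanonical /= a0 /= ffunE permK.
  by rewrite /th eqxx addbF.
- move=> x Dx; rewrite /F /vertex_of /= piQP // sP //; congr (_, _).
  apply/ffunP => Q; rewrite !ffunE thU //.
  rewrite -[in RHS](permKV piQ Q) piQE /piQ0 /= ffunE.
  by rewrite -sP // permK.
Qed.

End Extend.
End Valuations.

(** The universal structure and its canonical set depend on [r] alone, so all [m] partial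
    automorphisms extend on the same structure. *)
Lemma extension_property (m : nat) (T : finType) (r : rel T)
    (D : 'I_m -> pred T) (p : 'I_m -> T -> T) :
    semigeneric r ->
    (forall i, {in D i &, injective (p i)}) ->
    (forall i, {in D i &, forall x y, r (p i x) (p i y) = r x y}) ->
  exists (U : finType) (s : rel U) (g : 'I_m -> U -> U) (k : T -> U),
  [/\ system s g, saturated s g, injective k,
      forall x y, s (k x) (k y) = r x y
    & forall i x, D i x -> g i (k x) = k (p i x)].
Proof.
move=> sg p_inj p_edge.
have /choice[g gP] := fun i => vextend sg (p_inj i) (p_edge i).
exists (vertex T), (@vedge T r), g, (vertex_of r); split.
- split; first exact: vedge_semigeneric.
  by move=> i; have [] := gP i.
- exists (@vcanonical T); split.
  + by move=> i; have [] := gP i.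
  + exact: vcanonical_uniq.
  + exact: vcanonical_ex.
- exact: vertex_of_inj.
- exact: vertex_of_edge.
- by move=> i; have [] := gP i.
Qed.

(** * Generic tuples in the limit *)

Lemma semigeneric_tournamentP (T : Type) (r : rel T) :
  semigeneric_tournament r -> semigeneric r.
Proof.
case=> -[irr asym] [A [[_ Acov Aadj Anon] Apar]].
have Aex x : exists i, A i x.
  have [i _ Ai] : (\bigcup_i A i)%classic x by rewrite Acov.
  by exists i.
have nonadj x y : nonadjacent r x y <-> exists2 i, A i x & A i y.
  split=> [xy|[i Ax Ay]]; last by rewrite /nonadjacent !(Anon i).
  have [[i Ai] [j Aj]] := (Aex x, Aex y); exists i => //.
  have [->//|ij] := eqVneq i j; have := Aadj _ _ _ _ ij Ai Aj.
  by case/andP: xy => /negPf-> /negPf->.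
have Auniq i j x : A i x -> A j x -> i = j.
  move=> Ai Aj; apply/eqP/negP => /negP ij; have := Aadj _ _ _ _ ij Ai Aj.
  by rewrite addbb.
split=> //.
- move=> x y z /nonadj[i Ax Ay] /nonadj[j Ay' Az]; apply/nonadj.
  by exists i => //; rewrite (Auniq _ _ _ Ay Ay').
- move=> a b c d /nonadj[i Aa Ab] /nonadj[j Ac Ad]; rewrite /parity.
  have [->|ab] := pselect (a = b); first by rewrite addbb.
  have [->|cd] := pselect (c = d); first by rewrite !addbb.
  have := Apar i j a b c d Aa Ab ab Ac Ad cd.
  rewrite /edge_count !big_cons !big_nil !addn0 !oddD !oddb.
  by do 4!case: (r _ _).
Qed.

Lemma semigeneric_finite_tournament (T : finType) (r : rel T) :
  semigeneric r -> semigeneric_tournament r.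
Proof.
move=> sg; have dg : directed_graph r.
  by split; [exact: sg_irr sg|exact: sg_asym sg].
(* Parts are numbered by the rank of their representative; all other indices give empty parts. *)
pose A i := [set x | enum_rank (part_rep r x) = i :> nat]%classic.
have AE i x y : A i x -> A i y -> nonadjacent r x y.
  move=> /= Ex Ey; rewrite -(eq_part_rep sg); apply/eqP/enum_rank_inj/val_inj.
  by rewrite /= Ex Ey.
split=> //; exists A; split; first split.
- by move=> i j _ _ [x [<- <-]].
- by apply/seteqP; split=> // x _; exists (enum_rank (part_rep r x)).
- move=> i j x y ij Ax Ay; have Nxy : ~~ nonadjacent r x y.
    apply: contra ij; rewrite -(eq_part_rep sg) => /eqP E.
    by move: Ax Ay; rewrite /A /= E => -> ->.
  by rewrite (edge_opp sg Nxy); case: (r x y).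
- by move=> i x y Ax Ay; have /andP[] := AE _ _ _ Ax Ay.
- move=> i j a b c d Aa Ab _ Ac Ad _.
  have := sg_parity sg (AE _ _ _ Aa Ab) (AE _ _ _ Ac Ad).
  rewrite /edge_count /parity !big_cons !big_nil !addn0 !oddD !oddb.
  by do 4!case: (r _ _).
Qed.

Lemma extension_comp (m : nat) (T U V : Type)
    (r : rel T) (f : 'I_m -> T -> T) (s : rel U) (g : 'I_m -> U -> U)
    (q : rel V) (h : 'I_m -> V -> V) (k : T -> U) (l : U -> V) :
  extension r f s g k -> extension s g q h l -> extension r f q h (l \o k).
Proof.
move=> [ik ek ck] [il el cl]; split=> [|x y|i x] /=.
- exact: inj_comp.
- by rewrite el ek.
- by rewrite cl ck.
Qed.

(** * Finite systems realized in the limit *)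

Section FraisseLimit.
Variables (M : countType) (e : rel M).
Hypothesis hM :
  Fraisse_limit (fun (T : finType) (r : rel T) => semigeneric_tournament r) e.

Lemma age_semigeneric (T : finType) (k : T -> M) :
  injective k -> semigeneric (fun x y => e (k x) (k y)).
Proof. by move=> ik; apply/semigeneric_tournamentP/hM.2; exists k. Qed.

Lemma age_embedding (T : finType) (r : rel T) : semigeneric r ->
  exists2 k : T -> M, injective k & forall x y, e (k x) (k y) = r x y.
Proof.
by move=> /semigeneric_finite_tournament/(hM.2 T r).2[k [ik ek]]; exists k.
Qed.

Lemma homogeneous_aut (T : finType) (k l : T -> M) :
    injective k -> injective l ->
    (forall x y, e (k x) (k y) = e (l x) (l y)) ->
  exists g : Aut e, forall x, g (k x) = l x.
Proof.
move=> ik il kl.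
pose F y := if [pick x | k x == y] is Some x then l x else y.
have Fk x : F (k x) = l x.
  by rewrite /F; case: pickP => [z /eqP/ik->|/(_ x)] //; rewrite eqxx.
have [|||g gA gF] := hM.1 (range k) (range l) F.
- exact: finite_image.
- split=> [_ [x _ <-]|_ _ /set_mem[x _ <-] /set_mem[y _ <-]|_ [x _ <-]].
  + by rewrite Fk; exists x.
  + by rewrite !Fk => /il->.
  + by exists (k x); [exists x|rewrite Fk].
- by move=> _ _ [x _ <-] [y _ <-]; rewrite !Fk kl.
by exists (mk_aut gA) => x; rewrite mk_autE gF ?Fk //; exists x.
Qed.

(** Some embedding of [s] exists by universality, and homogeneity moves it onto the prescribed
    [j]. *)
Lemma embedding_extend (T U : finType) (s : rel U) (k : T -> U) (j : T -> M) :
    semigeneric s -> injective k -> injective j ->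
    (forall x y, e (j x) (j y) = s (k x) (k y)) ->
  exists l : U -> M,
    [/\ injective l, forall x y, e (l x) (l y) = s x y & forall x, l (k x) = j x].
Proof.
move=> sg ik ij ej; have [l il el] := age_embedding sg.
have [|||g gP] := @homogeneous_aut T (l \o k) j => //.
- exact: inj_comp.
- by move=> x y /=; rewrite el ej.
exists (g \o l); split=> [|x y|x] /=; last exact: gP.
  by apply: inj_comp il; exact: bij_inj (autP g).1.
by rewrite (autP g).2.
Qed.

Variable m : nat.
Implicit Types h : 'I_m -> Aut e.

Definition acts h : 'I_m -> M -> M := fun i => h i.

Lemma system_realize (T : finType) (r : rel T) f (j : T -> M) :
    system (m := m) r f -> injective j -> (forall x y, e (j x) (j y) = r x y) ->
  exists h, extension r f e (acts h) j.
Proof.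
move=> [_ sysf] ij ej.
have /choice[h hP] i : exists g : Aut e, forall x, g (j x) = j (f i x).
  apply: homogeneous_aut => // [|x y]; first exact: inj_comp (sysf i).1.
  by rewrite !ej (sysf i).2.
by exists h; split=> // i x; apply: hP.
Qed.

(** For fixed [h], these are the basic neighbourhoods of [h] in the topology of pointwise
    convergence. *)
Definition agree (F : seq M) h h' : Prop :=
  forall i x, x \in F -> h i x = h' i x.

Lemma extension_agree (T : finType) (r : rel T) f (j : T -> M) F h h' :
    (forall x, j x \in F) -> agree F h h' ->
  extension r f e (acts h) j -> extension r f e (acts h') j.
Proof.
by move=> jF hh [ij ej hj]; split=> // i x; rewrite -hj /acts hh.
Qed.

Lemma agree_sym F h h' : agree F h h' -> agree F h' h.
Proof. by move=> hh i x xF; rewrite hh. Qed.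

Lemma agree_sub (F F' : seq M) h h' :
  {subset F <= F'} -> agree F' h h' -> agree F h h'.
Proof. by move=> FF hh i x /FF; apply: hh. Qed.

(** On [F], the tuple consists of partial automorphisms of the finite structure [F1]. The extension
    property makes them total on a saturated structure, which is embedded in the limit over [F1]. *)
Lemma locally_finite_approximation h F :
  exists (T : finType) (r : rel T) (f : 'I_m -> T -> T) (j : T -> M) h',
    [/\ system r f, saturated r f, extension r f e (acts h') j, agree F h h'
      & forall x, x \in F -> exists t, j t = x].
Proof.
pose F1 := F ++ [seq h i x | i <- enum 'I_m, x <- F].
have FF1 x : x \in F -> x \in F1 by rewrite mem_cat => ->.
have hF1 i x : x \in F -> h i x \in F1.
  move=> xF; rewrite mem_cat; apply/orP; right.
  by apply/allpairsP; exists (i, x); rewrite mem_enum.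
pose T0 : finType := seq_sub F1; pose val0 (t : T0) : M := ssval t.
have val0_inj : injective val0 by apply: val_inj.
(* The default [t] occurs only when the image leaves [F1], never over [F]. *)
pose p i (t : T0) : T0 := insubd t (h i (val0 t)).
have pE i t : val0 t \in F -> val0 (p i t) = h i (val0 t).
  by move=> tF; rewrite /val0 /p [LHS]insubdK // hF1.
have h_inj i : injective (h i) by apply: bij_inj (autP (h i)).1.
have [|||U [s [g [k [sysU satU ik ek gk]]]]] :=
    @extension_property m T0 (fun x y => e (val0 x) (val0 y))
      (fun i => [pred t | val0 t \in F]) p.
- exact: age_semigeneric.
- move=> i x y xF yF /(congr1 val0); rewrite !pE // => /h_inj; exact: val0_inj.
- by move=> i x y xF yF; rewrite !pE // (autP (h i)).2.
have [|j [ij ej jk]] := embedding_extend (j := val0) sysU.1 ik val0_inj.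
  by move=> x y; rewrite ek.
have [h' hP] := system_realize sysU ij ej.
have valF x : x \in F -> exists t : T0, val0 t = x.
  by move=> xF; exists (SeqSub (FF1 x xF)).
exists U, s, g, j, h'; split=> // [i x xF|x xF].
  have [t tx] := valF x xF; have [_ _ hj] := hP.
  by rewrite -tx -pE ?tx // -tx -!jk -gk ?inE ?tx // [RHS]hj.
by have [t <-] := valF x xF; exists (k t).
Qed.

(** A finite system [V] first captures [h] on [F] and on the base. Amalgamating [V] with [U] over
    the base and realizing the result over [V] adds [U] without changing [h] on [F]. *)
Lemma saturated_extension_approximation (T U : finType) (r : rel T) f
    (s : rel U) g (k : T -> U) (j : T -> M) h F :
    system r f -> saturated r f -> system s g -> extension r f s g k ->
    extension r f e (acts h) j ->
  exists (l : U -> M) h',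
    [/\ agree F h h', extension s g e (acts h') l & forall x, l (k x) = j x].
Proof.
move=> sysT satT sysU extk extj.
have [V [q [p [jV [h1 [sysV _ extV hh1 FV]]]]]] :=
  locally_finite_approximation h (F ++ [seq j t | t <- enum T]).
have jF t : j t \in F ++ [seq j t | t <- enum T].
  by rewrite mem_cat map_f ?orbT // mem_enum.
have /choice[c jc] t : exists v, jV v = j t by apply: FV.
have [[ij ej hj] [iV eV hV]] := (extj, extV).
have extc : extension r f q p c.
  split=> [x y /(congr1 jV)|x y|i x]; first by rewrite !jc => /ij.
    by rewrite -eV !jc ej.
  by apply: iV; rewrite -hV !jc -hj /acts hh1.
have [W [w [a [j1 [j2 [sysW ext1 ext2 j12]]]]]] :=
  saturated_amalgamation sysT satT sysV sysU extc extk.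
have [i1 e1 a1] := ext1.
have [|l [il el lj]] := embedding_extend (j := jV) sysW.1 i1 iV.
  by move=> x y; rewrite e1 eV.
have [h' hP] := system_realize sysW il el.
exists (l \o j2), h'; split=> [i x xF||x] /=; last 1 first.
- by rewrite j12 lj jc.
- have [|v vx] := FV x; first by rewrite mem_cat xF.
  rewrite hh1 ?mem_cat ?xF // -vx [LHS]hV -!lj -a1; have [_ _ hl] := hP.
  by rewrite [RHS]hl.
- exact: extension_comp ext2 hP.
Qed.

Definition generic h : Prop :=
  (forall F : seq M,
    exists (T : finType) (r : rel T) (f : 'I_m -> T -> T) (j : T -> M),
    [/\ system r f, saturated r f, extension r f e (acts h) j
      & forall x, x \in F -> exists t, j t = x]) /\
  (forall (T U : finType) (r : rel T) f (s : rel U) g (k : T -> U) (j : T -> M),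
    system r f -> saturated r f -> system s g -> extension r f s g k ->
    extension r f e (acts h) j ->
    exists2 l : U -> M,
      extension s g e (acts h) l & forall x, l (k x) = j x).

(* Every finite system is isomorphic to one on some ['I_n], so that countably
   many codes suffice for the conditions defining [generic]. *)
Definition code : countType :=
  (seq M + {n : nat & {ffun 'I_n * 'I_n -> bool} * {ffun 'I_m * 'I_n -> 'I_n}
                      * {ffun 'I_n -> option M}}%type)%type.

Section Code.
Variables (n : nat) (R : {ffun 'I_n * 'I_n -> bool}).
Variables (a : {ffun 'I_m * 'I_n -> 'I_n}) (c : {ffun 'I_n -> option M}).

Let s : rel 'I_n := fun x y => R (x, y).
Let g i x := a (i, x).

(** The domain of [c] marks the base inside ['I_n], and its values are the embedding of the base in
    the limit. *)
Definition code_base h : Prop :=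
  exists (T : finType) (r : rel T) f (k : T -> 'I_n) (j : T -> M),
  [/\ [/\ system r f, saturated r f, extension r f s g k
        & extension r f e (acts h) j],
      forall t, c (k t) = Some (j t)
    & forall x y, c x = Some y -> exists t, x = k t].

Definition code_extends h : Prop :=
  code_base h -> system s g ->
  exists2 l, extension s g e (acts h) l & forall x y, c x = Some y -> l x = y.

Lemma code_extends_approximation h F : exists h' F',
  agree F h h' /\ forall h'', agree F' h' h'' -> code_extends h''.
Proof.
have [sys|Nsys] := pselect (system s g); last first.
  by exists h, [::]; split=> // h'' _ _ /Nsys.
have [hb|Nhb] := pselect (code_base h); last first.
  (* A base depends only on the tuple at the finitely many values of [c], so its absence persists
     for all nearby tuples. *)
  exists h, (pmap c (enum 'I_n)); split=> // h'' hh [T [r [f [k [j [H cj kc]]]]]] _.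
  case: Nhb; exists T, r, f, k, j; split=> //; case: H => ? ? ? H; split=> //.
  apply: extension_agree (agree_sym hh) H => t.
  by rewrite mem_pmap -cj map_f // mem_enum.
have [T [r [f [k [j [[sysT satT extk extj] cj kc]]]]]] := hb.
have [l [h' [hh' extl lk]]] :=
  saturated_extension_approximation F sysT satT sys extk extj.
exists h', [seq l x | x <- enum 'I_n]; split=> // h'' hh _ _; exists l.
  apply: extension_agree hh extl => x; apply: map_f; exact: mem_enum.
move=> x y cx; have [t xt] := kc _ _ cx.
by move: cx; rewrite xt cj lk => -[].
Qed.

End Code.

Definition code_cond (c : code) h : Prop :=
  match c with
  | inl F => exists (T : finType) (r : rel T) (f : 'I_m -> T -> T) (j : T -> M),
      [/\ system r f, saturated r f, extension r f e (acts h) j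
        & forall x, x \in F -> exists t, j t = x]
  | inr (existT n (R, a, p)) => code_extends R a p h
  end.

Lemma code_cond_approximation c h F : exists h' F',
  agree F h h' /\ forall h'', agree F' h' h'' -> code_cond c h''.
Proof.
case: c => [F1|[n [[R a] p]]]; last exact: code_extends_approximation.
have [T [r [f [j [h' [sysT satT extj hh FT]]]]]] :=
  locally_finite_approximation h (F ++ F1).
exists h', [seq j t | t <- enum T]; split.
  by apply: agree_sub hh => x; rewrite mem_cat => ->.
move=> h'' hh'; exists T, r, f, j; split=> // [|x xF]; last first.
  by apply: FT; rewrite mem_cat xF orbT.
apply: extension_agree hh' extj => t; apply: map_f; exact: mem_enum.
Qed.

Lemma code_cond_generic h : (forall c, code_cond c h) -> generic h.
Proof.
move=> hc; split=> [F|T U r f s g k j sysT satT sysU extk extj].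
  exact: hc (inl F).
(* The extension is transported to an ordinal by [enum_rank], where it has a code. *)
pose s' (x y : 'I_#|U|) := s (enum_val x) (enum_val y).
pose g' i (x : 'I_#|U|) := enum_rank (g i (enum_val x)).
have eU' : extension s g s' g' enum_rank.
  by split=> [|x y|i x]; rewrite /s' /g' ?enum_rankK //; exact: enum_rank_inj.
pose R := [ffun xy => s' xy.1 xy.2]; pose a := [ffun ix => g' ix.1 ix.2].
pose p := [ffun x : 'I_#|U| => omap j [pick t | k t == enum_val x]].
have sE : (fun x y => R (x, y)) = s'.
  by apply/funext => x; apply/funext => y; rewrite ffunE.
have aE : (fun i x => a (i, x)) = g'.
  by apply/funext => i; apply/funext => x; rewrite ffunE.
have [ik ek gk] := extk.
have pk t : p (enum_rank (k t)) = Some (j t).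
  rewrite ffunE enum_rankK; case: pickP => [t' /eqP/ik->|/(_ t)] //.
  by rewrite eqxx.
have : code_extends R a p h by exact: hc (inr (existT _ #|U| (R, a, p))).
rewrite /code_extends /code_base sE aE => he; have [||l extl lp] := he.
- exists T, r, f, (enum_rank \o k), j; split=> //.
    split=> //; exact: extension_comp extk eU'.
  move=> x y; rewrite ffunE; case: pickP => // t /eqP kt _.
  by exists t; rewrite /= kt enum_valK.
- split=> [|i]; first exact: semigeneric_pullback sysU.1.
  have [gi gs] := sysU.2 i; split=> [x y /enum_rank_inj/gi/enum_val_inj //|x y].
  by rewrite /s' /g' !enum_rankK gs.
exists (l \o enum_rank); first exact: extension_comp eU' extl.
by move=> x /=; apply: lp.
Qed.

End FraisseLimit.

(** * Neighbourhoods and Baire category for tuples of automorphisms *)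

Lemma cvg_initial (S : choiceType) (T : topologicalType) (f : S -> T)
    (F : set_system S) (s : S) : Filter F ->
  (f @ F --> f s -> F --> (s : initial_topology f))%classic.
Proof.
move=> FF fF A [_ [[B Bop <-] Bfs] sBA]; apply: filterS sBA _.
by apply: fF; apply: open_nbhs_nbhs.
Qed.

Section BaireCategory.
Variables (M : countType) (e : rel M) (m : nat).
Local Notation autos := {ptws 'I_m -> Aut e}.
Implicit Types h : autos.

Lemma nbhs_agree1 h i x : nbhs h [set h' : autos | h' i x = h i x]%classic.
Proof.
have ci : continuous (fun h' : autos => h' i).
  exact: (@proj_continuous 'I_m (fun=> Aut e) i).
have cx : continuous (fun f : {ptws M -> discrete_topology M} => f x).
  exact: (@proj_continuous M (fun=> discrete_topology M) x).
have cv : continuous (set_val : Aut e -> {ptws M -> discrete_topology M}).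
  exact: initial_continuous.
apply: (ci h [set g : Aut e | g x = h i x]%classic).
apply: (cv (h i) [set f : {ptws M -> discrete_topology M} | f x = h i x]%classic).
exact: (cx _ [set y | y = h i x]%classic (discrete_set1 _)).
Qed.

Lemma nbhs_agree h F : nbhs h [set h' : autos | agree F h h']%classic.
Proof.
elim: F => [|x F IH]; first by apply: (@filterE _ (nbhs h) _ _) => h' i x.
have H := @filter_forall _ 'I_m _ (nbhs h) (nbhs_filter h) (fun i => nbhs_agree1 h i x).
apply: (@filterS2 _ (nbhs h) (nbhs_filter h) _ _ _ _ IH H) => h' hF hx i y.
rewrite inE => /predU1P[->|/hF//].
exact: esym (hx i).
Qed.

(** The sets containing a basic one form a filter. Its convergence to [h] is checked at one index
    and one point at a time, through the layers product, subspace, product. *)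
Lemma agree_nbhs h (U : set autos) : nbhs h U ->
  exists F, forall h', agree F h h' -> U h'.
Proof.
pose G : set_system autos := [set A | exists F, forall h', agree F h h' -> A h']%classic.
have GF : Filter G.
  split=> [|A B [F FA] [F' FB]|A B AB [F FA]]; first by exists [::].
  - exists (F ++ F') => h' hh; split; [apply: FA|apply: FB]; apply: agree_sub hh.
      by move=> x; rewrite mem_cat => ->.
    by move=> x; rewrite mem_cat orbC => ->.
  - by exists F => h' /FA; apply: AB.
suff : (G --> h)%classic by apply.
apply/cvg_sup => i; apply: cvg_initial.
apply: (@cvg_initial (Aut e) _ set_val).
apply/cvg_sup => x; apply: cvg_initial.
apply/discrete_cvg; exists [:: x] => h' hh /=.
exact: esym (hh i x (mem_head _ _)).
Qed.

Section Approximation.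
Variable C : nat -> autos -> Prop.
Hypothesis C_approx : forall n h F, exists h' F',
  agree F h h' /\ forall h'', agree F' h' h'' -> C n h''.

(** [C_approx] says that each [C n] contains a dense open set, so its complement is nowhere
    dense. *)
Lemma comeagre_approximation (S : set autos) :
  (forall h, (forall n, C n h) -> S h) -> comeagre S.
Proof.
(* [meagre] asks for an equality, so the complements are cut down to that of [S]. *)
move=> CS; exists (fun n => [set h | ~ S h /\ ~ C n h]%classic).
  move=> n; apply/seteqP; split=> // h /agree_nbhs[F FA].
  have [h' [F' [hh hC]]] := C_approx n h F.
  by have [h'' [[_ NC] /hC]] := FA h' hh _ (nbhs_agree h' F').
apply/seteqP; split=> h; last by case=> n _ [].
move=> NS; have /existsNP[n nC] : ~ forall n, C n h by move=> /CS.
by exists n.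
Qed.

(** A sequence of shrinking basic neighbourhoods, the one of stage [n] inside [C n], has a pointwise
    limit; bookkeeping of preimages makes the limit maps onto. *)
Lemma baire_approximation : exists h, forall n, C n h.
Proof.
have stepP (nhF : nat * (autos * seq M)) : exists h'F' : autos * seq M,
  [/\ agree nhF.2.2 nhF.2.1 h'F'.1, {subset nhF.2.2 <= h'F'.2},
     forall h'', agree h'F'.2 h'F'.1 h'' -> C nhF.1 h''
   & forall x, unpickle nhF.1 = Some x ->
     x \in h'F'.2 /\ forall i, exists2 y, y \in h'F'.2 & h'F'.1 i y = x].
  case: nhF => n [h F] /=; have [h' [F' [hh hC]]] := C_approx n h F.
  (* Freezing [x] makes the limit defined at [x]; freezing its preimages puts [x] in the range. *)
  pose F1 := if unpickle n is Some x then
    x :: [seq aut_inv (h' i) x | i <- enum 'I_m] else [::].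
  exists (h', F ++ F' ++ F1); split=> //=.
  - by move=> x xF; rewrite mem_cat xF.
  - by move=> h'' hh''; apply: hC; apply: agree_sub hh'' => x xF';
      rewrite !mem_cat xF' orbT.
  - move=> x nx; rewrite /F1 nx !mem_cat mem_head !orbT; split=> // i.
    exists (aut_inv (h' i) x); last exact: aut_invK.
    rewrite !mem_cat inE; apply/orP; right; apply/orP; right; apply/orP; right.
    by apply/mapP; exists i; rewrite ?mem_enum.
have [step {}stepP] := choice stepP.
pose st := fix st n := if n is n'.+1 then step (n', st n')
                       else ((fun=> aut_one e) : autos, [::]).
pose H n := (st n).1; pose F n := (st n).2.
have F_mono n k : n <= k -> {subset F n <= F k}.
  elim: k => [|k IH]; first by rewrite leqn0 => /eqP->.
  rewrite leq_eqVlt => /predU1P[->//|/IH nk] x /nk xF.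
  by have [_ sF _ _] := stepP (k, st k); apply: sF.
have H_agree n k : n <= k -> agree (F n) (H n) (H k).
  elim: k => [|k IH]; first by rewrite leqn0 => /eqP->.
  rewrite leq_eqVlt => /predU1P[->//|nk] i x xF; rewrite (IH nk) //.
  by have [sH _ _ _] := stepP (k, st k); apply: sH; exact: (F_mono n).
have F_all x : x \in F (pickle x).+1.
  by have [_ _ _ /(_ x (pickleK x))[]] := stepP (pickle x, st (pickle x)).
(* The point [x] is handled by the step out of stage [pickle x], hence is frozen from the next stage
   on. *)
pose L i x := H (pickle x).+1 i x.
have LE n i x : x \in F n -> L i x = H n i x.
  move=> xF; have [le|/ltnW le] := leqP n (pickle x).+1.
    by rewrite /L -(H_agree _ _ le).
  by rewrite /L (H_agree _ _ le).
have L2 i x y : exists n, L i x = H n i x /\ L i y = H n i y.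
  exists (maxn (pickle x).+1 (pickle y).+1); split; apply: LE.
    by apply: F_mono (F_all x); exact: leq_maxl.
  by apply: F_mono (F_all y); exact: leq_maxr.
have Laut i : automorphism e (L i).
  split=> [|x y]; last first.
    by have [n [-> ->]] := L2 i x y; exact: (autP (H n i)).2.
  have Linj : injective (L i).
    move=> x y; have [n [-> ->]] := L2 i x y.
    by move/(bij_inj (autP (H n i)).1).
  have /choice[g gP] y : exists x, L i x = y.
    have [_ _ _ /(_ y (pickleK y))[_ /(_ i)[x xF xy]]] :=
      stepP (pickle y, st (pickle y)).
    by exists x; rewrite (LE (pickle y).+1).
  by exists g => // x; apply: Linj; rewrite gP.
exists (fun i => mk_aut (Laut i)) => n.
have [_ _ hC _] := stepP (n, st n); apply: hC => i x xF.
by rewrite mk_autE (LE n.+1).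
Qed.

End Approximation.
End BaireCategory.

(** * Back-and-forth *)

Lemma back_and_forth (M : countType) (Q : seq (M * M) -> Prop) (s0 : seq (M * M)) :
    Q s0 ->
    (forall s x, Q s -> exists s',
      [/\ Q s', {subset s <= s'} & exists y, (x, y) \in s']) ->
    (forall s y, Q s -> exists s',
      [/\ Q s', {subset s <= s'} & exists x, (x, y) \in s']) ->
    (forall s x y x' y', Q s -> (x, y) \in s -> (x', y') \in s ->
      x = x' <-> y = y') ->
  exists g : M -> M, bijective g /\
    forall x y, exists s, [/\ Q s, (x, g x) \in s, (y, g y) \in s
                          & forall z w, (z, w) \in s -> w = g z].
Proof.
move=> Q0 forth back Qfun.
(* [Q] stands inside the existential so that [choice] gives a step function on all lists. *)
have stepP (ns : nat * seq (M * M)) : exists s', Q ns.2 ->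
    [/\ Q s', {subset ns.2 <= s'} & forall x, unpickle ns.1 = Some x ->
      (exists y, (x, y) \in s') /\ exists y, (y, x) \in s'].
  case: ns => n s /=; have [Qs|NQ] := pselect (Q s); last first.
    by exists s => Qs; case: (NQ Qs).
  case: (unpickle n) => [x|]; last by exists s => _; split=> // x [].
  have [s1 [Q1 ss1 [y xy]]] := forth s x Qs.
  have [s2 [Q2 ss2 [z zx]]] := back s1 x Q1.
  exists s2 => _; split=> // [p /ss1/ss2 //|_ [<-]].
  by split; [exists y; apply: ss2|exists z].
have [step {}stepP] := choice stepP.
pose st := fix st n := if n is n'.+1 then step (n', st n') else s0.
have Qst n : Q (st n).
  by elim: n => // n Qn; have [] := stepP (n, st n) Qn.
have st_mono n k : n <= k -> {subset st n <= st k}.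
  elim: k => [|k IH]; first by rewrite leqn0 => /eqP->.
  rewrite leq_eqVlt => /predU1P[->//|/IH nk] x /nk xF.
  by have [_ sF _] := stepP (k, st k) (Qst k); apply: sF.
have dom x : exists y, (x, y) \in st (pickle x).+1.
  by have [_ _ /(_ x (pickleK x))[]] := stepP (pickle x, st (pickle x)) (Qst _).
have codom y : exists x, (x, y) \in st (pickle y).+1.
  by have [_ _ /(_ y (pickleK y))[]] := stepP (pickle y, st (pickle y)) (Qst _).
have [g gP] := choice dom; have [g' gP'] := choice codom.
have gE n x y : (x, y) \in st n -> y = g x.
  move=> xy; apply: (Qfun (st (maxn n (pickle x).+1)) x _ x _ _ _ _).1 => //.
    by apply: st_mono xy; exact: leq_maxl.
  by apply: st_mono (gP x); exact: leq_maxr.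
have g'E n x y : (x, y) \in st n -> x = g' y.
  move=> xy; apply: (Qfun (st (maxn n (pickle y).+1)) _ y _ y _ _ _).2 => //.
    by apply: st_mono xy; exact: leq_maxl.
  by apply: st_mono (gP' y); exact: leq_maxr.
exists g; split=> [|x y].
  by exists g' => x; [exact/esym/(g'E _ _ _ (gP x))|exact/esym/(gE _ _ _ (gP' x))].
(* One stage serves both points, so properties of pairs pass from the lists to [g]. *)
exists (st (maxn (pickle x).+1 (pickle y).+1)); split=> // [||z w].
- by apply: st_mono (gP x); exact: leq_maxl.
- by apply: st_mono (gP y); exact: leq_maxr.
- exact: gE.
Qed.

(** * Conjugacy of generic tuples *)

Section Main.
Variables (M : countType) (e : rel M) (m : nat).
Implicit Types h : 'I_m -> Aut e.

(** The list is the graph of an isomorphism between finite invariant saturated subsystems of [h] and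
    [h'], both given as images of one abstract system. *)
Definition matching h h' (s : seq (M * M)) : Prop :=
  exists (T : finType) (r : rel T) (f : 'I_m -> T -> T) (j j' : T -> M),
    [/\ system r f, saturated r f, extension r f e (acts h) j,
        extension r f e (acts h') j' & s = [seq (j t, j' t) | t <- enum T]].

Let swap (p : M * M) := (p.2, p.1).

Lemma matching_swap h h' s : matching h h' s -> matching h' h (map swap s).
Proof.
case=> T [r [f [j [j' [sysT satT ej ej' ->]]]]].
by exists T, r, f, j', j; split=> //; rewrite -map_comp.
Qed.

Lemma matchingP h h' s x y : matching h h' s -> (x, y) \in s ->
  exists (T : finType) (r : rel T) (f : 'I_m -> T -> T) (j j' : T -> M) t,
    [/\ system r f, extension r f e (acts h) j, extension r f e (acts h') j',
        s = [seq (j t, j' t) | t <- enum T] & x = j t /\ y = j' t].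
Proof.
case=> T [r [f [j [j' [sysT satT ej ej' ->]]]]] /mapP[t _ [-> ->]].
by exists T, r, f, j, j', t.
Qed.

(** Cofinality for [h] enlarges the system to contain [x]; universality for [h'] realizes the larger
    system over the old one. *)
Lemma matching_forth h h' s x : generic h -> generic h' -> matching h h' s ->
  exists s', [/\ matching h h' s', {subset s <= s'} & exists y, (x, y) \in s'].
Proof.
move=> [cofinal _] [_ universal] [T [r [f [j [j' [sysT satT ej ej' ->]]]]]].
have [U [q [g [l [sysU satU el Ul]]]]] := cofinal (x :: [seq j t | t <- enum T]).
have /choice[k lk] t : exists u, l u = j t.
  by apply: Ul; rewrite inE map_f ?orbT // mem_enum.
have [[ij rj hj] [il rl hl]] := (ej, el).
have ek : extension r f q g k.
  split=> [t t' /(congr1 l)|t t'|i t]; first by rewrite !lk => /ij.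
    by rewrite -rl !lk rj.
  by apply: il; rewrite -hl !lk hj.
have [l' el' lk'] := universal _ _ _ _ _ _ _ _ sysT satT sysU ek ej'.
exists [seq (l u, l' u) | u <- enum U]; split.
- by exists U, q, g, l, l'.
- move=> _ /mapP[t _ ->]; rewrite -lk -lk'.
  by apply/mapP; exists (k t); rewrite ?mem_enum.
- have [u ux] := Ul x (mem_head _ _); exists (l' u).
  by apply/mapP; exists u; rewrite ?mem_enum // ux.
Qed.

Lemma generic_conjugate h h' : generic h -> generic h' ->
  exists g : Aut e, diag_conj g h = h'.
Proof.
move=> gh gh'.
(* The empty system is vacuously saturated. *)
have Q0 : matching h h' [::].
  have f0 : 'I_m -> void -> void by move=> _ [].
  exists void, (fun _ _ => false), f0, (of_void M), (of_void M).
  split; try by split=> // -[].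
  - by split; [split=> -[]|split=> -[]].
  - by exists (fun=> true); split=> -[].
  - by case: (enum _) => // -[].
have [|||g [gb gP]] := back_and_forth Q0.
- by move=> s x; exact: matching_forth.
(* The back step is the forth step with the two tuples exchanged. *)
- move=> s y /matching_swap Qs.
  have [s' [Qs' ss' [x yx]]] := matching_forth y gh' gh Qs.
  exists (map swap s'); split; first exact: matching_swap.
    move=> [a b] ab; apply/mapP; exists (b, a) => //; apply: ss'.
    by apply/mapP; exists (a, b).
  by exists x; apply/mapP; exists (y, x).
- move=> s x y x' y' Qs /(matchingP Qs)[T [r [f [j [j' [t [_ [ij _ _] [ij' _ _] -> [-> ->]]]]]]]].
  by case/mapP=> t' _ [-> ->]; split=> [/ij->|/ij'->].
have gaut : automorphism e g.
  split=> // x y; have [s [Qs xs ys _]] := gP x y.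
  have [T [r [f [j [j' [t [_ [_ rj _] [_ rj' _] sE [-> ->]]]]]]]] := matchingP Qs xs.
  by move: ys; rewrite sE => /mapP[t' _ [-> ->]]; rewrite rj rj'.
exists (mk_aut gaut); apply/funext => i; apply: aut_ext => y.
have [x ->] : exists x, y = g x by have [g' _ gg'] := gb; exists (g' y); rewrite gg'.
rewrite /diag_conj /=.
have -> : ((mk_aut gaut * h i * (mk_aut gaut)^-1)%g : Aut e) (g x) = g (h i x).
  by congr (g (h i _)); exact: (aut_funK (mk_aut gaut)).
(* The matched systems are invariant, so the list also contains the pair of [h i x] and
   [h' i (g x)]. *)
have [s [Qs xs _ sg]] := gP x x.
have [T [r [f [j [j' [t [_ [_ _ hj] [_ _ hj'] sE [xj yj]]]]]]]] := matchingP Qs xs.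
rewrite yj [RHS]hj' xj [h i _]hj; apply/esym/sg.
by rewrite sE; apply: map_f; rewrite mem_enum.
Qed.

End Main.

Theorem theorem1p6 (M : countType) (e : rel M)
  (hM : Fraisse_limit (fun (T : finType) (r : rel T) => semigeneric_tournament r) e) :
  ample_generics e.
Proof.
move=> m _.
(* Numbers that code nothing carry the trivial condition. *)
pose C n (h : {ptws 'I_m -> Aut e}) :=
  if unpickle n is Some c then code_cond (c : code M m) h else True.
have C_approx n h F : exists h' F',
    agree F h h' /\ forall h'', agree F' h' h'' -> C n h''.
  rewrite /C; case: unpickle => [c|]; last by exists h, [::].
  exact: code_cond_approximation.
have C_generic h : (forall n, C n h) -> generic h.
  move=> hC; apply: code_cond_generic => c.
  by have := hC (pickle c); rewrite /C pickleK.
(* Any tuple meeting all conditions represents the comeagre orbit, as all such tuples are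
   conjugate. *)
have [h hC] := baire_approximation C_approx; exists h.
apply: (comeagre_approximation C_approx) => h' h'C.
have [g <-] := generic_conjugate (C_generic _ hC) (C_generic _ h'C).
by exists g.
Qed.
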